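(* Assume that $F$ is an odd function, and let $\Upsilon_F:=\sup_{v\in(0,1]}F(v)/v$ and $\Xi_F:=\inf\{v>0: F(v)\le v\}$. (1) If $\gamma>\Upsilon_F$, then $U_\infty\equiv0$. (2) If $\gamma<F'(0)$, then $\liminf_{x\to+\infty}U_\infty(x)\ge\Xi_F$.
   Context: Fix $\gamma>1$ and $\zeta>0$, offspring probabilities $p_n\ge 0$ ($n\ge1$) with $\sum_{n\ge1}p_n=1$, and threshold probabilities $\eta_{n,k}\ge0$ ($n\ge1$, $1\le k\le n$) with $\sum_{k=1}^n\eta_{n,k}=1$ for each $n$. Define $F:[-1,1]\to[-1,1]$ by $$F(u)=\sum_{n\ge1}2^{1-n}p_n\sum_{k=1}^n\eta_{n,k}\sum_{j=k}^n\binom nj(1+u)^j(1-u)^{n-j}-1 ,$$ so $F(\pm1)=\pm1$. The function $F$ is increasing and is taken to be $C^2$ on $[0,1]$. The function $u:[0,\infty)\times\mathbb{R}\to[-1,1]$ is the solution (in the Duhamel/mild sense) of $$\partial_tu(t,x)=\tfrac12\Delta u(t,x)+\zeta\bigl[F(u(t,\gamma^{-1}x))-u(t,x)\bigr]\ (t>0,\ x\in\mathbb{R}),\qquad u(0,x)=\operatorname{sgn}(x),$$ i.e. $u(t,\cdot)=e^{t(\frac12\Delta-\zeta)}\operatorname{sgn}+\zeta\int_0^te^{(t-s)(\frac12\Delta-\zeta)}\bigl[F(u(s,\gamma^{-1}\cdot))\bigr]\,ds$. (Probabilistic meaning: $u(t,x)=2p-1$, where $p$ is the probability that the initial particle, started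 at $x$ in generation $0$, votes $1$ in the random-threshold voting model on a branching Brownian motion in which generation-$k$ particles have generator $\frac12\gamma^{2k}\Delta$, branch at rate $\zeta$ into $n$ children with probability $p_n$, and particles alive at time $t$ vote the sign of their position; a parent of $n$ children votes $1$ iff at least $L$ of its children vote $1$, where $P(L=k)=\eta_{n,k}$.) When $F$ is odd, the limit $U_\infty(x):=\lim_{t\to\infty}u(t,x)$ exists for every $x\in\mathbb{R}$. *)

(* Defs.v *)
From HB Require Import structures.
From mathcomp Require Import all_boot all_order all_algebra.
From mathcomp Require Import all_classical all_reals all_analysis.

Set Implicit Arguments.
Unset Strict Implicit.
Unset Printing Implicit Defensive.

Import Order.TTheory GRing.Theory Num.Theory.
Import numFieldNormedType.Exports.

Local Open Scope classical_set_scope.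
Local Open Scope ring_scope.

(* Only the values on [-1, 1], where the series converges, are meaningful:
   elsewhere [limn] may be a junk value.  Note 2^(1 - n) = 2 / 2^n. *)
Definition voteF (R : realType) (p : nat -> R) (eta : nat -> nat -> R) (v : R)
    : R :=
  limn (fun N => \sum_(1 <= n < N)
    2 / 2 ^+ n * p n *
    \sum_(1 <= k < n.+1) eta n k *
      \sum_(k <= j < n.+1) 'C(n, j)%:R * (1 + v) ^+ j * (1 - v) ^+ (n - j))
  - 1.

(* Derivative relative to A: at a boundary point of an interval this is the
   one-sided derivative. *)
Definition is_derive_within (R : realType) (A : set R) (f df : R -> R) : Prop :=
  forall x, A x -> (f y - f x) / (y - x) @[y --> within A x^'] --> df x.

Definition C2_on (R : realType) (A : set R) (f : R -> R) : Prop :=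
  exists f1 f2 : R -> R,
    [/\ is_derive_within A f f1, is_derive_within A f1 f2
      & {within A, continuous f2}].

(* The heat semigroup e^{t Delta / 2}, for t >= 0.  The case t = 0 is separate
   because the library's normal law of standard deviation 0 is not a Dirac
   mass. *)
Definition heat (R : realType) (t : R) (f : R -> R) (x : R) : R :=
  if t == 0 then f x
  else \int[@lebesgue_measure R]_y (normal_pdf x (Num.sqrt t) y * f y).

(* e^{t (Delta / 2 - zeta)} *)
Definition killed_heat (R : realType) (zeta t : R) (f : R -> R) (x : R) : R :=
  expR (- zeta * t) * heat t f x.

(* [Num.sg 0 = 0].  Joint measurability and the range [-1, 1] make every
   integral below that of a bounded measurable function.  The values of [u] at
   negative times are irrelevant. *)
Definition mild_solution (R : realType) (gamma zeta : R) (F : R -> R)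
    (u : R -> R -> R) : Prop :=
  [/\ measurable_fun [set z : R * R | 0 <= z.1] (fun z => u z.1 z.2),
      forall t x, 0 <= t -> -1 <= u t x <= 1
    & forall t x, 0 <= t ->
        u t x = killed_heat zeta t Num.sg x
                + zeta * \int[@lebesgue_measure R]_(s in `[0, t])
                    killed_heat zeta (t - s) (fun y => F (u s (gamma^-1 * y))) x].

Definition Upsilon (R : realType) (F : R -> R) : R :=
  sup [set F v / v | v in `]0, 1]].

(* v <= 1 because F has domain [-1, 1]. *)
Definition Xi (R : realType) (F : R -> R) : R :=
  inf [set v | 0 < v <= 1 /\ F v <= v].

(* Main.v *)
Require Import Defs.
From HB Require Import structures.
From mathcomp Require Import all_boot all_order all_algebra.
From mathcomp Require Import all_classical all_reals all_analysis.
From mathcomp Require Import measurable_realfun ring lra.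

Set Implicit Arguments.
Unset Strict Implicit.
Unset Printing Implicit Defensive.

Import Order.TTheory GRing.Theory Num.Theory.
Import numFieldNormedType.Exports.

Local Open Scope classical_set_scope.
Local Open Scope ring_scope.

(** With tau exponential of rate zeta and Z standard normal, Duhamel's formula
    reads u(t,x) = E[K_t(tau, x + sqrt(min(tau,t)) Z)], where
    K_t(s,y) = F(u(t-s, y/gamma)) for s <= t and sgn y for s > t.  A one-sided
    bound on u with error k e^(lambda t) reproduces itself with error
    (k/2) e^(lambda t) when lambda is large, so every barrier preserved by this
    formula is a bound; oddness of u is obtained in this way.  Barriers only
    need to be compared on y >= 0: for odd functions the Gaussian kernel centred
    at x >= 0 preserves nonnegativity on the half-line (reflection).  As
    t -> oo the formula becomes U(x) = E[F(U((x + sqrt(tau) Z)/gamma))].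

    (1) If |F v| <= Upsilon |v| and Upsilon < gamma, a bound
    |U x| <= k (K x + 1) for x >= 0 improves to the same bound with rho k,
    rho < 1: the linear part contracts by Upsilon/gamma, and the constant part
    because E[sgn(x + sqrt(tau) Z)] <= theta + C x with theta small.

    (2) If F v >= b v near 0 with b > gamma, then small multiples of
    y |-> min(y, N), with N large, are lower barriers, so U is bounded below by
    a positive constant near +oo.  The supremum l of the constants c such that
    U >= c near +oo then satisfies F l <= l, whence l >= Xi_F. *)

(** * The voting nonlinearity *)

(** The probability that a binomial variable with parameters [n] and [q] is at least [k]. With
    [q = (1 + v) / 2] it is, up to the factor [2 ^+ n], the inner sum of [voteF]. *)
Definition tail (R : realType) (n k : nat) (q : R) : R :=
  \sum_(k <= j < n.+1) 'C(n, j)%:R * q ^+ j * (1 - q) ^+ (n - j).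

Lemma tail0 (R : realType) n (q : R) : tail n 0 q = 1.
Proof.
rewrite /tail big_mkord -[RHS](expr1n R n) -[in RHS](subrK q 1) exprDn.
apply: eq_bigr => i _; rewrite -mulr_natl; ring.
Qed.

Lemma tail_gt (R : realType) n k (q : R) : (n < k)%N -> tail n k q = 0.
Proof. by move=> nk; rewrite /tail big_geq. Qed.

(** Condition on one of the [n.+1] trials; algebraically this is Pascal's rule. *)
Lemma tailS (R : realType) n k (q : R) : (k <= n)%N ->
  tail n.+1 k.+1 q = q * tail n k q + (1 - q) * tail n k.+1 q.
Proof.
move=> kn.
have e1 : q * tail n k q =
    \sum_(k.+1 <= j < n.+2) 'C(n, j.-1)%:R * q ^+ j * (1 - q) ^+ (n.+1 - j).
  rewrite /tail big_distrr [RHS]big_add1 /=.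
  by apply: eq_bigr => i _; rewrite subSS exprS; ring.
have e2 : (1 - q) * tail n k.+1 q =
    \sum_(k.+1 <= j < n.+2) 'C(n, j)%:R * q ^+ j * (1 - q) ^+ (n.+1 - j).
  rewrite /tail big_distrr [RHS]big_nat_recr//= bin_small// !mul0r addr0.
  apply: eq_big_nat => i /andP[_ ilt]; rewrite subSn// exprS; ring.
rewrite e1 e2 -big_split /=; apply: eq_big_nat => -[//|i] _ /=.
by rewrite binS natrD; ring.
Qed.

Lemma tail_ge0 (R : realType) n k (q : R) : 0 <= q <= 1 -> 0 <= tail n k q.
Proof.
move=> /andP[q0 q1]; rewrite /tail big_seq; apply: sumr_ge0 => j _.
by rewrite !mulr_ge0 ?exprn_ge0// subr_ge0.
Qed.

Lemma tail_nincr (R : realType) n k (q : R) :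
  0 <= q <= 1 -> tail n k.+1 q <= tail n k q.
Proof.
move=> /andP[q0 q1]; have [kn|nk] := leqP k n; last by rewrite !tail_gt// ltnW.
rewrite [leRHS]/tail big_ltn// lerDr.
by rewrite !mulr_ge0 ?exprn_ge0// subr_ge0.
Qed.

(** Induction on [n]: by [tailS] the tail is a convex combination of two tails of order [n], and a
    larger [q] both raises these and moves weight to the larger one. *)
Lemma tail_homo (R : realType) n k (q r : R) :
  0 <= q -> q <= r -> r <= 1 -> tail n k q <= tail n k r.
Proof.
move=> q0 qr r1; have q01 : 0 <= q <= 1 by rewrite q0 (le_trans qr).
elim: n k => [|n IH] [|k]; rewrite ?tail0//; first by rewrite !tail_gt.
have [kn|nk] := leqP k n; last by rewrite !tail_gt.
rewrite !tailS//.
have := tail_nincr n k q01; have := IH k; have := IH k.+1.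
move: (tail n k q) (tail n k r) (tail n k.+1 q) (tail n k.+1 r) => a b c d.
nra.
Qed.

Lemma tail1 (R : realType) n k : (k <= n)%N -> tail n k (1 : R) = 1.
Proof.
move=> kn; rewrite /tail big_nat_recr//= binn subnn !expr1n !mulr1 subrr.
rewrite big_nat big1 ?add0r// => j /andP[_ jn].
by rewrite expr0n subn_eq0 leqNgt jn mulr0.
Qed.

Section vote.
Context (R : realType) (p : nat -> R) (eta : nat -> nat -> R).
Hypothesis p_ge0 : forall n, (1 <= n)%N -> 0 <= p n.
Hypothesis p_sum1 : \sum_(1 <= n < N) p n @[N --> \oo] --> (1 : R).
Hypothesis eta_ge0 : forall n k, (1 <= k <= n)%N -> 0 <= eta n k.
Hypothesis eta_sum1 : forall n, (1 <= n)%N -> \sum_(1 <= k < n.+1) eta n k = 1.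

(** The powers of 2 in [voteF] are absorbed by passing to the success probability [(1 + v) / 2],
    which leaves nonnegative terms on [-1, 1]. *)
Let partial (v : R) N := \sum_(1 <= n < N) 2 * p n *
  \sum_(1 <= k < n.+1) eta n k * tail n k ((1 + v) / 2).

Let voteFE v : voteF p eta v = limn (partial v) - 1.
Proof.
rewrite /voteF; congr (limn _ + _ : R); apply/funext => N; rewrite /partial.
apply: eq_bigr => n _; rewrite mulrAC -[RHS]mulrA mulrAC -!mulrA; congr (2 * _).
rewrite mulrCA; congr (_ * _); rewrite big_distrr/=; apply: eq_bigr => k _.
rewrite mulrCA; congr (_ * _); rewrite /tail big_distrr/= !big_nat.
apply: eq_bigr => j /andP[_ jn].
have -> : 1 - (1 + v) / 2 = (1 - v) / 2 :> R by field.
have e : (2 : R) ^+ n = 2 ^+ j * 2 ^+ (n - j) by rewrite -exprD subnKC.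
rewrite !expr_div_n e; field.
by rewrite !expf_neq0.
Qed.

Let half (v : R) : -1 <= v <= 1 -> 0 <= (1 + v) / 2 <= 1.
Proof. by move=> ?; lra. Qed.

Let partial_nd (v : R) : -1 <= v <= 1 -> nondecreasing_seq (partial v).
Proof.
move=> v1; apply/nondecreasing_seqP => -[|N].
  by rewrite /partial !big_geq.
rewrite /partial [leRHS]big_nat_recr//= lerDl mulr_ge0// ?mulr_ge0 ?p_ge0//.
rewrite big_nat; apply: sumr_ge0 => k /andP[k1 kn].
by rewrite mulr_ge0 ?tail_ge0 ?half// eta_ge0// k1.
Qed.

Let partial_sum_p N : \sum_(1 <= n < N) p n <= 1.
Proof.
rewrite -(cvg_lim _ p_sum1)//; apply: nondecreasing_cvgn_le; last first.
  by apply/cvg_ex; exists 1.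
apply/nondecreasing_seqP => -[|n]; first by rewrite !big_geq.
by rewrite [leRHS]big_nat_recr//= lerDl p_ge0.
Qed.

Let partial_ub (v : R) N : -1 <= v <= 1 -> partial v N <= 2.
Proof.
move=> v1; apply: (@le_trans _ _ (2 * \sum_(1 <= n < N) p n)); last first.
  by rewrite ler_piMr.
rewrite /partial big_distrr/= big_nat [leRHS]big_nat.
apply: ler_sum => n /andP[n1 _].
rewrite ler_piMr ?mulr_ge0 ?p_ge0//;
  apply: le_trans (_ : _ <= \sum_(1 <= k < n.+1) eta n k) _; last by rewrite eta_sum1.
rewrite big_nat [leRHS]big_nat; apply: ler_sum => k /andP[k1 kn]; rewrite ler_piMr ?eta_ge0 ?k1//.
have /andP[h0 h1] := half v1.
by rewrite -[leRHS](@tail1 R n k) ?tail_homo.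
Qed.

(** Monotone and bounded: on [-1, 1] [limn] is a true limit and not a default value. *)
Let partial_cvg (v : R) : -1 <= v <= 1 -> cvgn (partial v).
Proof.
move=> v1; apply: nondecreasing_is_cvgn; first exact: partial_nd.
by exists 2 => _ [N _ <-]; exact: partial_ub.
Qed.

Lemma voteF_nondecreasing (v w : R) : -1 <= v -> v <= w -> w <= 1 ->
  voteF p eta v <= voteF p eta w.
Proof.
move=> v1 vw w1; rewrite !voteFE lerB//; apply: ler_lim.
- by apply: partial_cvg; lra.
- by apply: partial_cvg; lra.
apply: nearW => N; rewrite /partial big_nat [leRHS]big_nat.
apply: ler_sum => n /andP[n1 _].
rewrite ler_wpM2l ?mulr_ge0 ?p_ge0// big_nat [leRHS]big_nat.
apply: ler_sum => k /andP[k1 kn]; rewrite ler_wpM2l ?eta_ge0 ?k1//.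
by apply: tail_homo; lra.
Qed.

Lemma voteF1 : voteF p eta 1 = 1.
Proof.
rewrite voteFE (_ : partial 1 = fun N => 2 * \sum_(1 <= n < N) p n).
  by rewrite (cvg_lim _ (cvgM (cvg_cst (2 : R)) p_sum1))//; ring.
apply/funext => N; rewrite /partial big_distrr/= big_nat [RHS]big_nat.
apply: eq_bigr => n /andP[n1 _].
transitivity (2 * p n * \sum_(1 <= k < n.+1) eta n k); last by rewrite eta_sum1// mulr1.
congr (_ * _); rewrite big_nat [RHS]big_nat; apply: eq_bigr => k /andP[k1 kn].
by rewrite (_ : (1 + 1) / 2 = 1 :> R) ?tail1 ?mulr1//; field.
Qed.

End vote.

(** * Derivatives relative to a set: Lipschitz bounds and the derivative at 0 *)

Lemma is_derive_within_approx (R : realType) (A : set R) (f df : R -> R) x e :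
  is_derive_within A f df -> A x -> 0 < e ->
  exists2 d, 0 < d & forall y, A y -> `|y - x| < d ->
    `|f y - f x - df x * (y - x)| <= e * `|y - x|.
Proof.
move=> dfA Ax e0; have /cvgrPdist_le/(_ _ e0) := dfA x Ax.
rewrite !near_withinE => /nbhs_ballP[d d0 Hd].
exists d => // y Ay yxd.
have [->|yx] := eqVneq y x; first by rewrite !subrr mulr0 subr0 !normr0 mulr0.
have yx0 : y - x != 0 by rewrite subr_eq0.
have := Hd y; rewrite /ball/= distrC => /(_ yxd yx Ay).
have -> : f y - f x - df x * (y - x) =
    - ((df x - (f y - f x) / (y - x)) * (y - x)) by field.
by move=> H; rewrite normrN normrM; apply: ler_wpM2r.
Qed.

Lemma is_derive_approx (R : realType) (f : R -> R) x l :
  (forall e, 0 < e -> exists2 d, 0 < d & forall y, `|y - x| < d ->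
    `|f y - f x - l * (y - x)| <= e * `|y - x|) -> is_derive x 1 f l.
Proof.
move=> H; suff cl : h^-1 *: ((f \o shift x) (h *: 1) - f x) @[h --> 0^'] --> l.
  by split; [apply/cvg_ex; exists l|exact/cvg_lim].
apply/cvgrPdist_le => e e0; have [d d0 Hd] := H e e0.
near=> h; have h0 : h != 0 by near: h; exact: nbhs_dnbhs_neq.
have := Hd (h + x); rewrite addrK => /(_ _) Hh.
rewrite /= [h *: 1]mulr1 /GRing.scale/=.
have -> : l - h^-1 * (f (h + x) - f x) = - (h^-1 * (f (h + x) - f x - l * h)).
  by field.
rewrite normrN normrM normfV mulrC ler_pdivrMr ?normr_gt0//; apply: Hh.
near: h; apply: dnbhs0_lt => //.
Unshelve. all: by end_near. Qed.

Lemma is_derive_within_continuous (R : realType) (A : set R) (f df : R -> R) :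
  is_derive_within A f df -> {within A, continuous f}.
Proof.
move=> dfA; apply/subspace_continuousP => x Ax; apply/cvgrPdist_le => e e0.
have [d d0 Hd] := is_derive_within_approx dfA Ax ltr01.
set C := 1 + `|df x|; have C0 : 0 < C by rewrite ltr_pwDl.
rewrite near_withinE; apply/nbhs_ballP.
exists (Num.min d (e / C)); first by rewrite /= lt_min d0 divr_gt0.
move=> y; rewrite /ball/= lt_min distrC => /andP[yd /ltW ye] Ay.
rewrite distrC (_ : f y - f x = (f y - f x - df x * (y - x)) + df x * (y - x)); last ring.
apply: (le_trans (ler_normD _ _)); rewrite normrM.
rewrite (le_trans (lerD (Hd y Ay yd) (lexx _)))// -mulrDl mulrC -/C.
by rewrite -ler_pdivlMr.
Qed.

(** The derivative [f1] is continuous, hence bounded by its extreme values on the segment, and the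
    mean value theorem applies on every subsegment. *)
Lemma is_derive_within_lipschitz (R : realType) (a b : R) (f f1 f2 : R -> R) :
  is_derive_within `[a, b] f f1 -> is_derive_within `[a, b] f1 f2 -> a <= b ->
  exists2 L, 0 <= L & forall x y, a <= x <= b -> a <= y <= b ->
    `|f x - f y| <= L * `|x - y|.
Proof.
move=> df df1 ab; have cf := is_derive_within_continuous df.
have cf1 := is_derive_within_continuous df1.
have [c1 _ Hc1] := EVT_max ab cf1; have [c2 _ Hc2] := EVT_min ab cf1.
exists (Num.max `|f1 c1| `|f1 c2|); first by rewrite le_max normr_ge0.
move=> x y xab yab; wlog xy : x y xab yab / x <= y => [W|].
  have [/W|/ltW/W] := leP x y; first exact.
  by rewrite distrC [`|y - x|]distrC; exact.
have [/andP[ax xb] /andP[ay yb]] := (xab, yab).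
have sub : `[x, y]%classic `<=` `[a, b]%classic.
  by move=> z /=; rewrite !in_itv/= => /andP[xz zy]; rewrite (le_trans ax)//= (le_trans zy).
have cxy : {within `[x, y], continuous f} by exact: continuous_subspaceW cf.
have dxy z : z \in `]x, y[%R -> is_derive z 1 f (f1 z).
  rewrite in_itv/= => /andP[xz zy]; apply: is_derive_approx => e e0.
  have zab : `[a, b]%classic z.
    by rewrite /= in_itv/= (ltW (le_lt_trans ax xz)) (ltW (lt_le_trans zy yb)).
  have [d d0 Hd] := is_derive_within_approx df zab e0.
  (* Keeping [w] inside [x, y] makes the relative derivative at the interior point [z] an ordinary
     one. *)
  exists (Num.min d (Num.min (z - x) (y - z))) => [|w].
    by rewrite !lt_min d0 !subr_gt0 xz.
  rewrite !lt_min => /and3P[wd + +]; rewrite !ltr_norml => /andP[w1 w2] /andP[w3 w4].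
  by apply: Hd => //; apply: sub; rewrite /= in_itv/=; apply/andP; split; lra.
have [c cxy' e] := MVT_segment xy dxy cxy.
rewrite distrC [`|x - y|]distrC e normrM ler_wpM2r// le_max.
have cab : c \in `[a, b]%R by apply: sub; exact: cxy'.
have := Hc1 c cab; have := Hc2 c cab; case: (leP 0 (f1 c)) => c0 l1 l2; apply/orP.
  by left; rewrite !ger0_norm// (le_trans c0).
by right; rewrite !ltr0_norm ?lerN2// (le_lt_trans l1).
Qed.

(** Oddness reflects the right difference quotients to the left, so the one-sided derivative at 0
    supplied by [C2_on] is the two-sided one. *)
Lemma odd_derive1_0 (R : realType) (f f1 : R -> R) (b : R) : 0 < b ->
  (forall v, -b <= v <= b -> f (- v) = - f v) -> is_derive_within `[0, b] f f1 ->
  derive1 f 0 = f1 0.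
Proof.
move=> b0 oddf df.
have f0 : f 0 = 0.
  by have := oddf 0; rewrite oppr0 oppr_le0 ltW// => /(_ isT); lra.
suff D : is_derive 0 (1 : R) f (f1 0) by rewrite derive1E derive_val.
have i0 : `[0, b]%classic (0 : R) by rewrite /= in_itv/= lexx ltW.
apply: is_derive_approx => e e0; have [d d0 Hd] := is_derive_within_approx df i0 e0.
exists (Num.min d b) => [|y]; first by rewrite lt_min d0.
rewrite lt_min f0 !subr0 => /andP[yd]; rewrite ltr_norml => /andP[yb1 yb2].
have [y0|y0] := leP 0 y.
  have iy : `[0, b]%classic y by rewrite /= in_itv/= y0 ltW.
  by have := Hd y iy; rewrite f0 !subr0; exact.
have iy : `[0, b]%classic (- y) by rewrite /= in_itv/=; apply/andP; split; lra.
have := Hd (- y) iy; rewrite f0 !subr0 oddf; last by apply/andP; split; lra.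
by rewrite normrN mulrN opprK addrC distrC; exact.
Qed.

(** * Means with respect to a probability density *)

Section weighted_mean.
Context d (T : measurableType d) (R : realType) (mu : {measure set T -> \bar R}).
Implicit Types f g : T -> R.

(** Such functions are integrable against any probability density, so the mean is linear and
    monotone on them. *)
Definition bmeas f := measurable_fun setT f /\ exists C, forall x, `|f x| <= C.

Lemma bmeas_le C f : measurable_fun setT f -> (forall x, `|f x| <= C) -> bmeas f.
Proof. by move=> mf fC; split => //; exists C. Qed.

Lemma bmeas_cst c : bmeas (fun _ => c).
Proof. by split; [exact: measurable_cst|exists `|c|]. Qed.

Lemma bmeasD f g : bmeas f -> bmeas g -> bmeas (fun x => f x + g x).
Proof.
move=> [mf [C fC]] [mg [D gD]]; split; first exact: measurable_funD.
by exists (C + D) => x; rewrite (le_trans (ler_normD _ _))// lerD.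
Qed.

Lemma bmeasM f g : bmeas f -> bmeas g -> bmeas (fun x => f x * g x).
Proof.
move=> [mf [C fC]] [mg [D gD]]; split; first exact: measurable_funM.
by exists (C * D) => x; rewrite normrM ler_pM.
Qed.

Lemma bmeasZ c f : bmeas f -> bmeas (fun x => c * f x).
Proof. exact/bmeasM/bmeas_cst. Qed.

Lemma bmeasN f : bmeas f -> bmeas (fun x => - f x).
Proof.
by move=> [mf [C fC]]; split; [exact: measurable_funN|exists C => x; rewrite normrN].
Qed.

Lemma bmeasB f g : bmeas f -> bmeas g -> bmeas (fun x => f x - g x).
Proof. by move=> bf bg; apply: bmeasD => //; exact: bmeasN. Qed.

Context (w : T -> R) (mw : measurable_fun setT w) (w_ge0 : forall x, 0 <= w x).
Hypothesis w_int : (\int[mu]_x (w x)%:E = 1)%E.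

Definition wmean f := \int[mu]_x (w x * f x).

Lemma integrable_weight : mu.-integrable setT (EFin \o w).
Proof.
apply/integrableP; split; first exact/measurable_EFinP.
by under eq_integral do rewrite /= ger0_norm//; rewrite w_int ltry.
Qed.

Lemma integrable_wmul f : bmeas f -> mu.-integrable setT (EFin \o (fun x => w x * f x)).
Proof.
move=> [mf [C fC]].
have iC : mu.-integrable setT (fun x => C%:E * (w x)%:E)%E.
  by apply: integrableZl => //; exact: integrable_weight.
apply: le_integrable iC => //.
  exact/measurable_EFinP/measurable_funM.
move=> x _ /=; rewrite lee_fin !normrM mulrC ler_wpM2r//.
by rewrite (le_trans (fC x))// ler_norm.
Qed.

Lemma wmean_EFin f : bmeas f -> (\int[mu]_x (w x * f x)%:E = (wmean f)%:E)%E.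
Proof. by move=> bf; rewrite fineK// integrable_fin_num//; exact: integrable_wmul. Qed.

Lemma eq_wmean f g : f =1 g -> wmean f = wmean g.
Proof. by move=> fg; apply: eq_Rintegral => x _; rewrite fg. Qed.

Lemma wmean_cst c : wmean (fun _ => c) = c.
Proof.
rewrite /wmean RintegralZr//; last exact: integrable_weight.
by rewrite /Rintegral w_int/= mul1r.
Qed.

Lemma wmeanD f g : bmeas f -> bmeas g ->
  wmean (fun x => f x + g x) = wmean f + wmean g.
Proof.
move=> bf bg; rewrite /wmean -RintegralD//; [|exact: integrable_wmul..].
by apply: eq_Rintegral => x _; rewrite mulrDr.
Qed.

Lemma wmeanZ c f : bmeas f -> wmean (fun x => c * f x) = c * wmean f.
Proof.
move=> bf; rewrite /wmean -RintegralZl//; last exact: integrable_wmul.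
by apply: eq_Rintegral => x _; rewrite mulrCA.
Qed.

Lemma wmeanN f : bmeas f -> wmean (fun x => - f x) = - wmean f.
Proof.
by move=> bf; rewrite -mulN1r -wmeanZ//; apply: eq_wmean => x; rewrite mulN1r.
Qed.

Lemma wmeanB f g : bmeas f -> bmeas g ->
  wmean (fun x => f x - g x) = wmean f - wmean g.
Proof. by move=> bf bg; rewrite wmeanD ?wmeanN//; exact: bmeasN. Qed.

(** The pointwise bound is asked only where the density is positive; for the exponential law this
    restricts comparisons to times [s >= 0]. *)
Lemma le_wmean f g : bmeas f -> bmeas g -> (forall x, 0 < w x -> f x <= g x) ->
  wmean f <= wmean g.
Proof.
move=> bf bg fg; apply: le_Rintegral => //; [exact: integrable_wmul..|].
move=> x _; have := w_ge0 x; rewrite le_eqVlt => /predU1P[<-|w0].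
  by rewrite !mul0r.
by rewrite ler_wpM2l// fg.
Qed.

Lemma wmean_bound C f : bmeas f -> (forall x, `|f x| <= C) -> `|wmean f| <= C.
Proof.
move=> bf fC; rewrite ler_norml -{1}(wmean_cst C) -{2}(wmean_cst C).
rewrite -wmeanN; last exact: bmeas_cst.
by apply/andP; split; apply: le_wmean => //; try exact: bmeas_cst;
  move=> x _; have := fC x; rewrite ler_norml => /andP[].
Qed.

(** Dominated convergence with dominating function [C * w]. *)
Lemma cvg_wmean C (f_ : nat -> T -> R) f :
  (forall n, measurable_fun setT (f_ n)) -> measurable_fun setT f ->
  (forall n x, `|f_ n x| <= C) ->
  (forall x, 0 < w x -> f_ n x @[n --> \oo] --> f x) ->
  wmean (f_ n) @[n --> \oo] --> wmean f.
Proof.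
move=> mf_ mf f_C cf.
have iC : mu.-integrable setT (fun x => C%:E * (w x)%:E)%E.
  by apply: integrableZl => //; exact: integrable_weight.
have [] := @dominated_convergence _ _ _ mu setT measurableT
  (fun n x => (w x * f_ n x)%:E) (fun x => (w x * f x)%:E)
  (fun x => (C%:E * (w x)%:E))%E.
- by move=> n; exact/measurable_EFinP/measurable_funM.
- exact/measurable_EFinP/measurable_funM.
- apply: aeW => x _; apply/cvg_EFin; first by near=> n.
  have := w_ge0 x; rewrite le_eqVlt => /predU1P[<-|w0].
    rewrite mul0r (_ : _ \o _ = fun=> 0); first exact: cvg_cst.
    by apply/funext => n /=; rewrite mul0r.
  by apply: cvgM; [exact: cvg_cst|exact: cf].
- exact: iC.
- apply: aeW => x n _.
  by rewrite /= lee_fin normrM (ger0_norm (w_ge0 _)) mulrC ler_wpM2r.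
move=> If _ H; rewrite /wmean /Rintegral.
by apply: fine_cvg; rewrite fineK// integrable_fin_num.
Unshelve. all: by end_near.
Qed.

End weighted_mean.

(** * Affine substitution in Lebesgue integrals *)

Section lebesgue_substitution.
Context (R : realType).
Local Notation mu := (@lebesgue_measure R).
Local Open Scope ereal_scope.

(** Lebesgue measure is [a] times its own pushforward under the affine map: the two agree on
    half-open intervals, hence on all measurable sets. *)
Lemma ge0_integral_affine (a b : R) (g : R -> \bar R) : (0 < a)%R ->
  measurable_fun setT g -> (forall y, 0 <= g y) ->
  \int[mu]_z g (b + a * z)%R = a^-1%:E * \int[mu]_y g y.
Proof.
move=> a0 mg g0; pose phi (z : measurableTypeR R) : measurableTypeR R := (b + a * (z : R))%R.
have mphi : measurable_fun setT (phi : R -> R).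
  by apply: measurable_funD => //; apply: measurable_funM.
pose nu : {measure set (measurableTypeR R) -> \bar R} :=
  mscale (NngNum (ltW a0)) (pushforward mu phi).
have nuE A : measurable A -> mu A = a%:E * mu (phi @^-1` A).
  move=> mA; rewrite (@lebesgue_measure_unique R (nu mphi))// => _ [[x y] _ <-].
  rewrite /nu/= /mscale/= /pushforward.
  have -> : phi @^-1` `]x, y] = `]((x - b) / a)%R, ((y - b) / a)%R]%classic.
    apply/seteqP; split => z /=;
      by rewrite /phi !in_itv/= ltr_pdivrMr// ler_pdivlMr// ltrBlDl lerBrDl (mulrC z).
  rewrite !lebesgue_measure_itv/= !lte_fin ltr_pM2r ?invr_gt0// ltrD2r.
  case: ifPn => _; last by rewrite mule0.
  by rewrite -!EFinB -EFinM; congr EFin; field; rewrite gt_eqF.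
rewrite (_ : \int[mu]_z _ = \int[pushforward mu phi]_y g y); last first.
  by rewrite ge0_integral_pushforward.
rewrite -(ge0_integral_mscale mu measurableT (NngNum (ltW (eqbRL (invr_gt0 a) a0))))//.
apply: eq_measure_integral => A mA _; rewrite /= /mscale/= /pushforward [in RHS]nuE//.
by rewrite muleA -EFinM mulVf ?gt_eqF// mul1e.
Qed.

Lemma ge0_integralN (g : R -> \bar R) :
  measurable_fun setT g -> (forall y, 0 <= g y) ->
  \int[mu]_z g (- z)%R = \int[mu]_y g y.
Proof.
move=> mg g0; rewrite (_ : \int[mu]_z _ =
    \int[pushforward mu (-%R : _ -> measurableTypeR R)]_y g y); last first.
  by rewrite ge0_integral_pushforward.
by apply: eq_measure_integral => A mA _; exact: lebesgue_measureN.
Qed.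

Local Close Scope ereal_scope.

Lemma Rintegral_affine (a b : R) (g : R -> R) : 0 < a ->
  mu.-integrable setT (EFin \o g) ->
  \int[mu]_z g (b + a * z) = a^-1 * \int[mu]_y g y.
Proof.
move=> a0 ig; have mg : measurable_fun setT (EFin \o g) by case/integrableP: ig.
rewrite /Rintegral [in LHS]integralE [in RHS]integralE.
rewrite (_ : (fun x => (g (b + a * x))%:E)^\+%E =
    (fun x => (EFin \o g)^\+%E (b + a * x)));
  last by apply/funext => x; rewrite ?funeposE ?funenegE.
rewrite (_ : (fun x => (g (b + a * x))%:E)^\-%E =
    (fun x => (EFin \o g)^\-%E (b + a * x)));
  last by apply/funext => x; rewrite ?funeposE ?funenegE.
rewrite !ge0_integral_affine//; [|exact: measurable_funeneg|exact: measurable_funepos].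
rewrite -muleBr//; last by rewrite fin_num_adde_defr// integrable_pos_fin_num.
rewrite fineM// fin_numB integrable_pos_fin_num// integrable_neg_fin_num//.
Qed.

Lemma RintegralN (g : R -> R) : mu.-integrable setT (EFin \o g) ->
  \int[mu]_z g (- z) = \int[mu]_y g y.
Proof.
move=> ig; have mg : measurable_fun setT (EFin \o g) by case/integrableP: ig.
rewrite /Rintegral [in LHS]integralE [in RHS]integralE.
rewrite (_ : (fun x => (g (- x))%:E)^\+%E = (fun x => (EFin \o g)^\+%E (- x)));
  last by apply/funext => x; rewrite ?funeposE ?funenegE.
rewrite (_ : (fun x => (g (- x))%:E)^\-%E = (fun x => (EFin \o g)^\-%E (- x)));
  last by apply/funext => x; rewrite ?funeposE ?funenegE.
by rewrite !ge0_integralN//; [exact: measurable_funeneg|exact: measurable_funepos].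
Qed.

End lebesgue_substitution.

(** * Product densities and Gaussian means *)

Section product_weight.
Context d1 d2 (T1 : measurableType d1) (T2 : measurableType d2) (R : realType).
Context (m1 : {sigma_finite_measure set T1 -> \bar R}).
Context (m2 : {sigma_finite_measure set T2 -> \bar R}).
Context (w1 : T1 -> R) (w2 : T2 -> R).
Hypothesis mw1 : measurable_fun setT w1.
Hypothesis mw2 : measurable_fun setT w2.
Hypothesis w1_ge0 : forall x, 0 <= w1 x.
Hypothesis w2_ge0 : forall x, 0 <= w2 x.
Hypothesis w1_int : (\int[m1]_x (w1 x)%:E = 1)%E.
Hypothesis w2_int : (\int[m2]_x (w2 x)%:E = 1)%E.

Definition weight2 (z : T1 * T2) : R := w1 z.1 * w2 z.2.

Lemma measurable_weight2 : measurable_fun setT weight2.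
Proof. by apply: measurable_funM; apply: measurableT_comp. Qed.

Lemma weight2_ge0 z : 0 <= weight2 z.
Proof. exact: mulr_ge0. Qed.

Lemma weight2_int : (\int[m1 \x m2]_z (weight2 z)%:E = 1)%E.
Proof.
have mW : measurable_fun setT (fun z => (weight2 z)%:E).
  apply/measurable_EFinP; exact: measurable_weight2.
have W0 z : (0 <= (weight2 z)%:E)%E by rewrite lee_fin weight2_ge0.
rewrite fubini_tonelli1//=.
rewrite -w1_int; apply: eq_integral => x _; rewrite /fubini_F/=.
under eq_integral do rewrite /weight2/= EFinM.
rewrite ge0_integralZl//= ?w2_int ?mule1 ?lee_fin//.
  exact/measurable_EFinP.
by move=> y _; rewrite lee_fin.
Qed.

Let E f := wmean (m1 \x m2)%E weight2 f.

Lemma bmeas_section (f : T1 * T2 -> R) x : bmeas f -> bmeas (fun y => f (x, y)).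
Proof.
move=> [mf [C fC]]; split; last by exists C.
exact: measurableT_comp.
Qed.

Lemma bmeas_wmean_section (f : T1 * T2 -> R) :
  bmeas f -> bmeas (fun x => wmean m2 w2 (fun y => f (x, y))).
Proof.
move=> bf; have [mf [C fC]] := bf; split; last first.
  by exists C => x; apply: wmean_bound => //; exact: bmeas_section.
(* the Tonelli measurability lemma wants a nonnegative integrand *)
rewrite (_ : (fun x => _) = fun x =>
    wmean m2 w2 (fun y => f (x, y) + C) - C); last first.
  apply/funext => x; rewrite wmeanD//; [|exact: bmeas_section|exact: bmeas_cst].
  by rewrite wmean_cst// addrK.
apply: measurable_funB => //; apply/measurable_EFinP.
pose g (z : T1 * T2) := (w2 z.2 * (f z + C))%:E.
have mg : measurable_fun setT g.
  apply/measurable_EFinP/measurable_funM; first exact: measurableT_comp.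
  exact: measurable_funD.
have g0 z : (0 <= g z)%E.
  rewrite lee_fin mulr_ge0//; have := fC z; rewrite ler_norml => /andP[+ _]; lra.
rewrite (_ : _ \o _ = fubini_F m2 g); first exact: measurable_fun_fubini_tonelli_F.
apply/funext => x /=; rewrite /fubini_F /g/= wmean_EFin//.
by apply: bmeasD; [exact: bmeas_section|exact: bmeas_cst].
Qed.

Lemma wmean_fubini (f : T1 * T2 -> R) : bmeas f ->
  E f = wmean m1 w1 (fun x => wmean m2 w2 (fun y => f (x, y))).
Proof.
move=> bf; rewrite /E {1}/wmean /Rintegral -integral12_prod_meas1; last first.
  apply: (@integrable_wmul _ _ _ _ weight2) => //; [exact: measurable_weight2|
    exact: weight2_ge0|exact: weight2_int].
rewrite [RHS]/wmean /Rintegral; congr fine; apply: eq_integral => x _.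
rewrite /fubini_F/= EFinM -wmean_EFin//; last exact: bmeas_section.
rewrite -integralZl//=; last exact/integrable_wmul/bmeas_section.
by apply: eq_integral => y _; rewrite /weight2/= -EFinM mulrA.
Qed.

End product_weight.

Section gaussian_mean.
Context (R : realType).
Local Notation mu := (@lebesgue_measure R).
Implicit Types (f h : R -> R).

Definition gmean f := wmean mu (normal_pdf 0 1) f.

Lemma normal_pdf_affine (x s z : R) : 0 < s ->
  normal_pdf x s (x + s * z) = s^-1 * normal_pdf 0 1 z.
Proof.
move=> s0; rewrite !normal_pdfE ?gt_eqF// /normal_peak /normal_fun mulrA.
congr (_ * expR _).
  rewrite expr1n -mulrnAr sqrtrM ?sqr_ge0// sqrtr_sqr gtr0_norm// mul1r.
  by rewrite invfM.
by rewrite addrC addKr subr0 expr1n; field; rewrite gt_eqF.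
Qed.

Lemma bmeas_affine f (x s : R) : bmeas f -> bmeas (fun z => f (x + s * z)).
Proof.
move=> [mf [C fC]]; split; last by exists C.
by apply: measurableT_comp => //; apply: measurable_funD => //; exact: measurable_funM.
Qed.

Lemma gmean_normal f (x s : R) : 0 < s -> bmeas f ->
  \int[mu]_y (normal_pdf x s y * f y) = gmean (fun z => f (x + s * z)).
Proof.
move=> s0 bf.
have ig : mu.-integrable setT (EFin \o (fun y => normal_pdf x s y * f y)).
  apply: integrable_wmul => //; [exact: measurable_normal_pdf|
    exact: normal_pdf_ge0|exact: integral_normal_pdf].
have := Rintegral_affine x s0 ig.
have -> : \int[mu]_z (normal_pdf x s (x + s * z) * f (x + s * z)) =
    s^-1 * gmean (fun z => f (x + s * z)).
  rewrite /gmean /wmean -RintegralZl//; last first.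
    apply: integrable_wmul => //; [exact: measurable_normal_pdf|
      exact: normal_pdf_ge0|exact: integral_normal_pdf|exact: bmeas_affine].
  by apply: eq_Rintegral => z _; rewrite normal_pdf_affine// mulrA.
by move=> /mulfI ->//; rewrite invr_neq0// gt_eqF.
Qed.

Lemma gmean_cst (c : R) : gmean (fun=> c) = c.
Proof.
apply: wmean_cst => //; [exact: measurable_normal_pdf|exact: normal_pdf_ge0|
  exact: integral_normal_pdf].
Qed.

Let mpdf : measurable_fun (setT : set (measurableTypeR R)) (@normal_pdf R 0 1) :=
  measurable_normal_pdf 0 1.
Let pdf_ge0 := @normal_pdf_ge0 R 0 1.
Let pdf_int := @integral_normal_pdf R 0 1.

Lemma gmeanD f h : bmeas f -> bmeas h -> gmean (fun z => f z + h z) = gmean f + gmean h.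
Proof. by move=> bf bh; rewrite /gmean (wmeanD mpdf pdf_ge0 pdf_int bf bh). Qed.

Lemma gmeanZ (c : R) f : bmeas f -> gmean (fun z => c * f z) = c * gmean f.
Proof. by move=> bf; rewrite /gmean (wmeanZ mpdf pdf_ge0 pdf_int _ bf). Qed.

Lemma le_gmean f h : bmeas f -> bmeas h -> (forall z, f z <= h z) -> gmean f <= gmean h.
Proof.
by move=> bf bh fh; apply: (le_wmean mpdf pdf_ge0 pdf_int bf bh) => z _; exact: fh.
Qed.

(** The standardised form also covers the degenerate time [t = 0], where the standard deviation
    vanishes. *)
Lemma heat_gmean (t x : R) f : 0 <= t -> bmeas f ->
  heat t f x = gmean (fun z => f (x + Num.sqrt t * z)).
Proof.
move=> t0 bf; rewrite /heat; case: ifPn => [/eqP ->|tn0].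
  rewrite sqrtr0 (_ : (fun z => _) = fun=> f x) ?gmean_cst//.
  by apply/funext => z; rewrite mul0r addr0.
by rewrite gmean_normal// sqrtr_gt0 lt_neqAle eq_sym tn0.
Qed.

(* The Gaussian density centred at x >= 0 gives more weight to y >= 0 than
   to - y. *)
Lemma odd_gmean_ge0 h (x s : R) : bmeas h -> (forall y, h (- y) = - h y) ->
  (forall y, 0 <= y -> 0 <= h y) -> 0 <= x -> 0 <= s ->
  0 <= gmean (fun z => h (x + s * z)).
Proof.
move=> bh hodd h0 x0; rewrite le_eqVlt => /predU1P[<-|s0].
  rewrite (_ : (fun z => _) = fun=> h x) ?gmean_cst ?h0//.
  by apply/funext => z; rewrite mul0r addr0.
rewrite -gmean_normal//.
pose g m y := normal_pdf m s y * h y.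
have ig m : mu.-integrable setT (EFin \o g m).
  apply: integrable_wmul => //; [exact: measurable_normal_pdf|
    exact: normal_pdf_ge0|exact: integral_normal_pdf].
(* The substitution of [- y] for [y] turns the centre [x] into [- x] and, [h] being odd, changes the
   sign. Twice the integral is then that of [h] against the difference of the two densities, and
   both factors have the sign of [y]. *)
rewrite -/(g x); have e : \int[mu]_y g x y = - \int[mu]_y g (- x) y.
  rewrite -mulN1r -RintegralZl// -RintegralN//; apply: eq_Rintegral => y _.
  rewrite /g hodd mulN1r mulrN !normal_pdfE ?gt_eqF// /normal_fun.
  by rewrite (_ : (- y - x) ^+ 2 = (y - - x) ^+ 2)//; ring.
rewrite -(@pmulr_rge0 _ 2)// mulr_natl mulr2n {2}e -RintegralB//; last exact: (ig x).
apply: Rintegral_ge0 => y _; rewrite /g -mulrBl.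
rewrite !normal_pdfE ?gt_eqF// -mulrBr -mulrA mulr_ge0 ?normal_peak_ge0//.
rewrite /normal_fun; have [y0|y0] := leP 0 y.
  rewrite mulr_ge0 ?h0// subr_ge0 ler_expR ler_wpM2r//.
    by rewrite invr_ge0 mulrn_wge0// sqr_ge0.
  nra.
rewrite mulr_le0//; last by rewrite -oppr_ge0 -hodd h0// oppr_ge0 ltW.
rewrite subr_le0 ler_expR ler_wpM2r//.
  by rewrite invr_ge0 mulrn_wge0// sqr_ge0.
nra.
Qed.

Lemma gmeanN h : bmeas h -> gmean (fun z => h (- z)) = gmean h.
Proof.
move=> bh; rewrite /gmean /wmean -[RHS]RintegralN; last first.
  by apply: integrable_wmul.
apply: eq_Rintegral => y _; rewrite !normal_pdfE// /normal_fun.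
by rewrite !subr0 sqrrN.
Qed.

End gaussian_mean.

(** * Duhamel's formula as an expectation *)

Section duhamel.
Context (R : realType) (zeta : R) (zeta_gt0 : 0 < zeta).
Local Notation mu := (@lebesgue_measure R).

Lemma integrable_affine (a b : R) (g : R -> R) : 0 < a ->
  mu.-integrable setT (EFin \o g) ->
  mu.-integrable setT (EFin \o (fun z => g (b + a * z))).
Proof.
move=> a0 /integrableP[mg ig]; apply/integrableP; split.
  apply/measurable_EFinP; move/measurable_EFinP in mg.
  by apply: measurableT_comp => //; apply: measurable_funD => //; exact: measurable_funM.
rewrite (ge0_integral_affine b a0 (g := fun y => `|(g y)%:E|%E))//; last first.
  by apply: measurableT_comp.
by rewrite lte_mul_pinfty// lee_fin invr_ge0 ltW.
Qed.

Lemma Rintegral_reflect (t : R) (g : R -> R) : mu.-integrable setT (EFin \o g) ->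
  \int[mu]_s g (t - s) = \int[mu]_s g s.
Proof.
move=> ig; have := Rintegral_affine t ltr01 ig; rewrite invr1 mul1r => <-.
rewrite -[RHS]RintegralN; last exact: (integrable_affine t ltr01 ig).
by apply: eq_Rintegral => s _; rewrite mul1r.
Qed.

Lemma integrable_reflect (t : R) (g : R -> R) : mu.-integrable setT (EFin \o g) ->
  mu.-integrable setT (EFin \o (fun s => g (t - s))).
Proof.
move=> ig; have /integrableP[mg fg] := integrable_affine t ltr01 ig.
move/measurable_EFinP in mg.
have eg : (fun s => g (t - s)) = (fun z => g (t + 1 * z)) \o -%R.
  by apply/funext => s /=; rewrite mul1r.
apply/integrableP; split.
  by apply/measurable_EFinP; rewrite eg; exact: measurableT_comp.
rewrite eg (@ge0_integralN _ (fun z => `|(g (t + 1 * z))%:E|%E))//.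
by apply: measurableT_comp => //; exact/measurable_EFinP.
Qed.

Definition emean (f : R -> R) := wmean mu (exponential_pdf zeta) f.

Let epdf_ge0 s : 0 <= exponential_pdf zeta s.
Proof. by apply: exponential_pdf_ge0; exact: ltW. Qed.

Let epdf_int : (\int[mu]_s (exponential_pdf zeta s)%:E = 1)%E.
Proof. exact: integral_exponential_pdf. Qed.

Let mepdf := measurable_exponential_pdf zeta.

Lemma emean_tail t : 0 <= t ->
  emean (fun s => if s <= t then 0 else 1) = expR (- zeta * t).
Proof.
move=> t0.
have mi : bmeas (fun s : R => (s <= t)%R%:R : R).
  apply: (@bmeas_le _ _ _ 1) => [|s]; last by case: (s <= t)%R; rewrite ?normr1 ?normr0.
  rewrite (_ : (fun s => _) = (fun s => if s <= t then 1 else 0 : R)); last first.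
    by apply/funext => s; case: (s <= t)%R.
  by apply: measurable_fun_ifT => //; exact: measurable_fun_ler.
rewrite (_ : (fun s => _) = fun s => 1 - (s <= t)%R%:R); last first.
  by apply/funext => s; case: (s <= t)%R; rewrite ?subrr ?subr0.
rewrite /emean wmeanB//; last exact: bmeas_cst.
rewrite wmean_cst//; suff -> : wmean mu (exponential_pdf zeta)
    (fun s => (s <= t)%R%:R) = 1 - expR (- zeta * t) by ring.
transitivity (\int[mu]_(s in `[0, t]) exponential_pdf zeta s).
  rewrite [RHS]Rintegral_mkcond; apply: eq_Rintegral => s _.
  rewrite patchE mem_setE in_itv/=; have [s0|s0] := leP 0 s.
    by case: (s <= t)%R; rewrite ?mulr1 ?mulr0.
  by rewrite lt0_exponential_pdf// mul0r.
move: t0; rewrite le_eqVlt => /predU1P[<-|t0].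
  by rewrite set_itv1 Rintegral_set1 mulr0 expR0 subrr.
by rewrite /Rintegral [X in fine X](exponential_prob_itv0c zeta t0).
Qed.

Definition Emean (f : R * R -> R) :=
  wmean (mu \x mu)%E (weight2 (exponential_pdf zeta) (normal_pdf 0 1)) f.

(** Standard deviation of the displacement at the branching time [s] or at [t], whichever comes
    first. *)
Definition clock (t : R) (s : R) := Num.sqrt (Num.min s t).

Lemma Emean_fubini (f : R * R -> R) : bmeas f ->
  Emean f = emean (fun s => gmean (fun z => f (s, z))).
Proof.
move=> bf; apply: wmean_fubini => //.
- exact: measurable_normal_pdf.
- by move=> z; exact: normal_pdf_ge0.
- exact: integral_normal_pdf.
Qed.

Lemma bmeas_gmean (f : R * R -> R) : bmeas f ->
  bmeas (fun s => gmean (fun z => f (s, z))).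
Proof.
move=> bf; have := @bmeas_wmean_section _ _ (measurableTypeR R) (measurableTypeR R)
  R mu (normal_pdf 0 1)
  (measurable_normal_pdf 0 1) (normal_pdf_ge0 0 1) (integral_normal_pdf 0 1).
by move=> /(_ _ bf).
Qed.

Lemma measurable_clock t : measurable_fun setT (clock t).
Proof.
apply: measurableT_comp; first by apply: continuous_measurable_fun; exact: sqrt_continuous.
exact: measurable_minr.
Qed.

(** The factor [c] takes the values 1 and -1, so that the walk and its reflection are covered
    together. *)
Lemma measurable_walk (c x : R) (sigma : R -> R) : measurable_fun setT sigma ->
  measurable_fun setT (fun p : R * R => (p.1, x + sigma p.1 * (c * p.2))).
Proof.
move=> ms; apply: measurable_fun_pair => //; apply: measurable_funD => //.
by apply: measurable_funM; [exact: measurableT_comp|exact: measurable_funM].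
Qed.

Lemma bmeas_walk (h : R * R -> R) (c x : R) (sigma : R -> R) : measurable_fun setT sigma ->
  bmeas h -> bmeas (fun p : R * R => h (p.1, x + sigma p.1 * (c * p.2))).
Proof.
move=> ms [mh [C hC]]; split; last by exists C.
by apply: measurableT_comp => //; exact: measurable_walk.
Qed.

Lemma bmeas_if (v : R -> R -> R) (f0 : R -> R) t :
  bmeas (fun p : R * R => v p.1 p.2) -> bmeas f0 ->
  bmeas (fun p : R * R => if p.1 <= t then v (t - p.1) p.2 else f0 p.2).
Proof.
move=> [mv [C vC]] [mf [D fD]]; split; last first.
  exists (Num.max C D) => p; case: ifP => _; rewrite le_max ?fD ?orbT//.
  by rewrite (vC (t - p.1, p.2)).
apply: measurable_fun_ifT.
- by apply: measurable_fun_ler.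
- apply: (measurableT_comp mv (g := fun p : R * R => (t - p.1, p.2))).
  by apply: measurable_fun_pair => //; exact: measurable_funB.
- exact: measurableT_comp.
Qed.

(** Condition on the first branching time. With probability [expR (- zeta * t)] it exceeds [t] and
    gives the killed heat flow of [f0]; otherwise its density gives the integral, after the time
    reversal [s] to [t - s]. *)
Lemma duhamel_Emean (v : R -> R -> R) (f0 : R -> R) t x : 0 <= t ->
  bmeas (fun p : R * R => v p.1 p.2) -> bmeas f0 ->
  killed_heat zeta t f0 x +
    zeta * \int[mu]_(s in `[0, t]) killed_heat zeta (t - s) (v s) x =
  Emean (fun p => let y := x + clock t p.1 * p.2 in
                  if p.1 <= t then v (t - p.1) y else f0 y).
Proof.
move=> t0 bv bf0.
pose K (p : R * R) := if p.1 <= t then v (t - p.1) p.2 else f0 p.2.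
have bK : bmeas K by exact: bmeas_if.
have bKw : bmeas (fun p : R * R => K (p.1, x + clock t p.1 * p.2)).
  rewrite (_ : (fun p => _) = fun p : R * R => K (p.1, x + clock t p.1 * (1 * p.2))).
    by apply: bmeas_walk => //; exact: measurable_clock.
  by apply/funext => p; rewrite mul1r.
rewrite -/(Emean (fun p => K (p.1, x + clock t p.1 * p.2))) Emean_fubini//.
pose h s := gmean (fun z => K (s, x + clock t s * z)).
have bh : bmeas h by exact: (bmeas_gmean bKw).
have bvs s : bmeas (v s) by exact: (bmeas_section s bv).
have hl s : 0 <= s <= t -> h s = heat s (v (t - s)) x.
  move=> /andP[s0 st]; rewrite heat_gmean//; congr gmean; apply/funext => z.
  by rewrite /K/= st /clock min_l.
have hr s : t < s -> h s = heat t f0 x.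
  move=> ts; rewrite heat_gmean//; congr gmean; apply/funext => z.
  by rewrite /K/= leNgt ts/= /clock min_r// ltW.
pose i (s : R) : R := if s <= t then 1 else 0.
have bi : bmeas i.
  apply: (@bmeas_le _ _ _ 1) => [|s]; last by rewrite /i; case: ifP; rewrite ?normr1 ?normr0.
  by apply: measurable_fun_ifT => //; exact: measurable_fun_ler.
pose j (s : R) : R := if s <= t then 0 else 1.
have bj : bmeas j.
  apply: (@bmeas_le _ _ _ 1) => [|s]; last by rewrite /j; case: ifP; rewrite ?normr1 ?normr0.
  by apply: measurable_fun_ifT => //; exact: measurable_fun_ler.
(* Beyond [t] the inner mean is the constant [heat t f0 x], so the two events separate through the
   indicators [j] and [i]. *)
rewrite [RHS](_ : _ = emean (fun s => heat t f0 x * j s + h s * i s)); last first.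
  congr emean; apply/funext => s; rewrite -[LHS]/(h s) /i /j.
  case: leP => st; first by rewrite mulr0 add0r mulr1.
  by rewrite mulr0 addr0 mulr1 hr.
rewrite /emean wmeanD//; [|exact: bmeasZ|exact: bmeasM].
rewrite wmeanZ// -/(emean j) emean_tail// {1}/killed_heat mulrC; congr (_ + _).
pose b s := exponential_pdf zeta s * (h s * i s).
have ib : mu.-integrable setT (EFin \o b).
  by apply: integrable_wmul => //; exact: bmeasM.
rewrite -[wmean _ _ _]/(\int[mu]_s b s) -(Rintegral_reflect t ib).
have z0 : zeta != 0 by rewrite gt_eqF.
apply/esym/(canRL (mulVKf z0)).
rewrite -RintegralZl//; last exact: integrable_reflect.
rewrite [RHS]Rintegral_mkcond.
(* The restriction to [0, t] comes from two factors: the exponential density at [t - s] vanishes for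
   [s > t], and [i (t - s)] vanishes for [s < 0]. *)
apply: eq_Rintegral => s _; apply/esym; rewrite patchE mem_setE in_itv/= /b.
have [st|ts] := leP s t; last first.
  by rewrite andbF lt0_exponential_pdf ?mul0r ?mulr0// subr_lt0.
have ts0 : (t - s <= t) = (0 <= s) by rewrite gerBl.
have [s0|s0] := leP 0 s; last by rewrite /i ts0 leNgt s0/= !mulr0.
rewrite exponential_pdfE ?subr_ge0// /i ts0 s0 mulr1.
rewrite hl; last by rewrite subr_ge0 st ts0.
by rewrite subKr /killed_heat -!mulrA mulKf.
Qed.

End duhamel.

(** * Order, symmetry and exponential discounting for [Emean] *)

Section Emean_theory.
Context (R : realType) (zeta : R) (zeta_gt0 : 0 < zeta).
Local Notation mu := (@lebesgue_measure R).
Local Notation E := (Emean zeta).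
Local Notation w := (weight2 (exponential_pdf zeta) (@normal_pdf R 0 1)).
Implicit Types (f g h : R * R -> R) (sigma : R -> R).

Let epdf_ge0 s : 0 <= exponential_pdf zeta s.
Proof. by apply: exponential_pdf_ge0; exact: ltW. Qed.

Let mw : measurable_fun setT w.
Proof.
apply: measurable_weight2; first exact: measurable_exponential_pdf.
exact: measurable_normal_pdf.
Qed.

Let w_ge0 p : 0 <= w p.
Proof. by apply: weight2_ge0 => // z; exact: normal_pdf_ge0. Qed.

Let w_int : (\int[(mu \x mu)]_p (w p)%:E = 1)%E.
Proof.
apply: weight2_int => //; [exact: measurable_exponential_pdf|
  exact: measurable_normal_pdf|by move=> z; exact: normal_pdf_ge0|
  exact: integral_exponential_pdf|exact: integral_normal_pdf].
Qed.

Let w_gt0 p : 0 < w p -> 0 <= p.1.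
Proof.
move=> wp; rewrite leNgt; apply/negP => p0.
by move: wp; rewrite /weight2 lt0_exponential_pdf// mul0r ltxx.
Qed.

Lemma le_Emean f g : bmeas f -> bmeas g -> (forall s z, 0 <= s -> f (s, z) <= g (s, z)) ->
  E f <= E g.
Proof.
move=> bf bg fg; apply: le_wmean => // -[s z] /w_gt0; exact: fg.
Qed.

Lemma Emean_cst c : E (fun=> c) = c.
Proof. exact: wmean_cst. Qed.

Lemma EmeanD f g : bmeas f -> bmeas g -> E (fun p => f p + g p) = E f + E g.
Proof. by move=> bf bg; exact: wmeanD. Qed.

Lemma EmeanB f g : bmeas f -> bmeas g -> E (fun p => f p - g p) = E f - E g.
Proof. by move=> bf bg; exact: wmeanB. Qed.

Lemma EmeanN f : bmeas f -> E (fun p => - f p) = - E f.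
Proof. by move=> bf; exact: wmeanN. Qed.

Lemma EmeanZ c f : bmeas f -> E (fun p => c * f p) = c * E f.
Proof. by move=> bf; exact: wmeanZ. Qed.

Lemma cvg_Emean C (f_ : nat -> R * R -> R) f :
  (forall n, measurable_fun setT (f_ n)) -> measurable_fun setT f ->
  (forall n p, `|f_ n p| <= C) ->
  (forall s z, 0 <= s -> f_ n (s, z) @[n --> \oo] --> f (s, z)) ->
  E (f_ n) @[n --> \oo] --> E f.
Proof.
move=> mf_ mf f_C cf; apply: (@cvg_wmean _ (measurableTypeR R * measurableTypeR R)%type R (mu \x mu)%E w
  mw w_ge0 w_int C f_ f mf_ mf f_C) => -[s z] /w_gt0; exact: cf.
Qed.

Lemma Emean_evenz f : bmeas f -> E (fun p => f (p.1, - p.2)) = E f.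
Proof.
move=> bf; rewrite !Emean_fubini//; last first.
  have [mf [C fC]] := bf; split; last by exists C.
  apply: (measurableT_comp mf (g := fun p : R * R => (p.1, - p.2))).
  by apply: measurable_fun_pair => //; exact: measurableT_comp.
congr emean; apply/funext => s.
exact: (gmeanN (bmeas_section s bf)).
Qed.

Lemma bmeas_walk1 h x sigma : measurable_fun setT sigma -> bmeas h ->
  bmeas (fun p => h (p.1, x + sigma p.1 * p.2)).
Proof.
move=> ms bh; rewrite (_ : (fun p => _) = fun p => h (p.1, x + sigma p.1 * (1 * p.2))).
  exact: (bmeas_walk 1 x ms bh).
by apply/funext => p; rewrite mul1r.
Qed.

Lemma bmeas_walkN h x sigma : measurable_fun setT sigma -> bmeas h ->
  bmeas (fun p => h (p.1, x - sigma p.1 * p.2)).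
Proof.
move=> ms bh; rewrite (_ : (fun p => _) = fun p => h (p.1, x + sigma p.1 * (-1 * p.2))).
  exact: (bmeas_walk (-1) x ms bh).
by apply/funext => p; rewrite mulN1r mulrN.
Qed.

Lemma Emean_walkN h x sigma : measurable_fun setT sigma -> bmeas h ->
  E (fun p => h (p.1, x - sigma p.1 * p.2)) = E (fun p => h (p.1, x + sigma p.1 * p.2)).
Proof.
move=> ms bh; rewrite -[RHS]Emean_evenz; last exact: (bmeas_walk1 x ms bh).
by congr (E _); apply/funext => p; rewrite mulrN.
Qed.

(** The Gaussian variable is symmetric, so the integrand may be averaged over [z] and [- z]. *)
Lemma Emean_symm h x sigma : measurable_fun setT sigma -> bmeas h ->
  E (fun p => h (p.1, x + sigma p.1 * p.2)) =
  2^-1 * E (fun p => h (p.1, x + sigma p.1 * p.2) + h (p.1, x - sigma p.1 * p.2)).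
Proof.
move=> ms bh; rewrite EmeanD; [|exact: (bmeas_walk1 x ms bh)|exact: (bmeas_walkN x ms bh)].
by rewrite (Emean_walkN x ms bh); field.
Qed.

(** For each fixed time this is [odd_gmean_ge0]. Applied to the difference of an odd function and an
    odd barrier, it reduces their comparison to [y >= 0]. *)
Lemma Emean_odd_ge0 h x sigma : measurable_fun setT sigma -> (forall s, 0 <= sigma s) ->
  bmeas h -> (forall s y, 0 <= s -> h (s, - y) = - h (s, y)) ->
  (forall s y, 0 <= s -> 0 <= y -> 0 <= h (s, y)) -> 0 <= x ->
  0 <= E (fun p => h (p.1, x + sigma p.1 * p.2)).
Proof.
move=> ms s0 bh hodd h0 x0; have bhw := bmeas_walk1 x ms bh.
rewrite Emean_fubini//.
have e0 : emean zeta (fun=> 0 : R) = 0.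
  by apply: wmean_cst => //; [exact: measurable_exponential_pdf|
    exact: integral_exponential_pdf].
rewrite -e0; apply: le_wmean => //.
- exact: measurable_exponential_pdf.
- exact: integral_exponential_pdf.
- exact: bmeas_cst.
- exact: bmeas_gmean bhw.
- move=> s ws; have s_ge0 : 0 <= s.
    by rewrite leNgt; apply/negP => /lt0_exponential_pdf e; rewrite e ltxx in ws.
  apply: (@odd_gmean_ge0 _ (fun y => h (s, y)) x (sigma s)) => //.
  + exact: (bmeas_section s bh).
  + by move=> y; exact: hodd.
  + by move=> y; exact: h0.
Qed.

(** The absolute value keeps the factor bounded for negative [s], where the exponential density
    vanishes. *)
Definition discount (lam s : R) : R := expR (- (lam * `|s|)).

Lemma bmeas_discount lam : 0 <= lam -> bmeas (fun p : R * R => discount lam p.1).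
Proof.
move=> lam0; apply: (@bmeas_le _ _ _ 1) => [|p]; last first.
  by rewrite ger0_norm ?expR_ge0// -expR0 ler_expR oppr_le0 mulr_ge0.
have md : measurable_fun setT (discount lam).
  rewrite /discount; apply: measurableT_comp => //; apply: measurableT_comp => //.
  by apply: measurable_funM => //; exact: normr_measurable.
exact: (measurableT_comp md).
Qed.

(** The Laplace transform of the exponential law: the tilted density is a multiple of the
    exponential density of rate [zeta + lam]. *)
Lemma Emean_discount lam : 0 <= lam ->
  E (fun p => discount lam p.1) = zeta / (zeta + lam).
Proof.
move=> lam0; have zl0 : 0 < zeta + lam by rewrite ltr_pwDl.
rewrite Emean_fubini//; last exact: bmeas_discount.
transitivity (\int[mu]_s (zeta / (zeta + lam) * exponential_pdf (zeta + lam) s)).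
  apply: eq_Rintegral => s _; rewrite [gmean _](gmean_cst (discount lam s)).
  have [s0|s0] := leP 0 s; last first.
    by rewrite !lt0_exponential_pdf// mul0r mulr0.
  rewrite !exponential_pdfE// /discount ger0_norm//.
  rewrite (_ : - (zeta + lam) * s = - zeta * s - lam * s); last by ring.
  by rewrite expRD; field; rewrite gt_eqF.
rewrite RintegralZl//; last exact: integrable_exponential_pdf.
by rewrite /Rintegral integral_exponential_pdf// mulr1.
Qed.

End Emean_theory.

(** * Small-ball bounds for the mean sign *)

Section small_ball.
Context (R : realType) (zeta : R) (zeta_gt0 : 0 < zeta).
Local Notation mu := (@lebesgue_measure R).

Lemma bmeas_sg : bmeas (Num.sg : R -> R).
Proof.
apply: (@bmeas_le _ _ _ 1) => [|x]; last by rewrite normr_sg; case: eqP.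
rewrite (_ : Num.sg = fun x : R => if x <= 0 then (if 0 <= x then 0 else -1) else 1).
  by do 2 (apply: measurable_fun_ifT => //; first exact: measurable_fun_ler).
apply/funext => x; have [x0|x0|->] := ltrgtP x 0.
- by rewrite ltr0_sg.
- by rewrite gtr0_sg.
- by rewrite sgr0.
Qed.

Definition small (a : R) (z : R) : R := if `|z| <= a then 1 else 0.

Lemma bmeas_small d (T : measurableType d) (a : R) (f : T -> R) :
  measurable_fun setT f -> bmeas (fun x => small a (f x)).
Proof.
move=> mf; apply: (@bmeas_le _ _ _ 1) => [|x].
  apply: measurable_fun_ifT => //; apply: measurable_fun_ler => //.
  exact: measurableT_comp.
by rewrite /small; case: ifP; rewrite ?normr1 ?normr0.
Qed.

Lemma gmean_small_le (a : R) : 0 <= a -> gmean (small a) <= 2 * normal_peak 1 * a.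
Proof.
move=> a0; apply: (@le_trans _ _ (\int[mu]_(z in `[- a, a]) normal_pdf 0 1 z)).
  rewrite le_eqVlt; apply/orP; left; apply/eqP.
  rewrite [RHS]Rintegral_mkcond; apply: eq_Rintegral => z _.
  by rewrite patchE mem_setE in_itv/= /small ler_norml; case: ifP; rewrite ?mulr1 ?mulr0.
apply: (@le_trans _ _ (\int[mu]_(z in `[- a, a]) normal_peak 1)); last first.
  rewrite Rintegral_cst//= lebesgue_measure_itv/= lte_fin.
  case: ifPn => [_|]; first by rewrite -EFinB/= opprK; lra.
  by move=> _ /=; rewrite mulr0 !mulr_ge0 ?normal_peak_ge0.
apply: le_Rintegral => //.
- by apply: integrableS (integrable_normal_pdf 0 1).
- apply: continuous_compact_integrable; first exact: segment_compact.
  by move=> x; exact: cvg_cst.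
- by move=> z _; apply: normal_pdf_ub.
Qed.

(** Average over [z] and [- z]: the signs of [x + sigma * z] and [x - sigma * z] cancel when
    [sigma * z] exceeds [x] in absolute value, which leaves the Gaussian mass of a ball of radius
    [x / sigma]. *)
Lemma gmean_sg_le (x sigma : R) : 0 <= x -> 0 < sigma ->
  gmean (fun z => Num.sg (x + sigma * z)) <= 2 * normal_peak 1 * (x / sigma).
Proof.
move=> x0 s0; have bs := bmeas_affine x sigma bmeas_sg.
have bsN : bmeas (fun z : R => Num.sg (x + sigma * - z)).
  rewrite (_ : (fun z => _) = fun z : R => Num.sg (x + - sigma * z)).
    exact: (bmeas_affine x (- sigma) bmeas_sg).
  by apply/funext => z; rewrite mulrN mulNr.
have bm : bmeas (small (x / sigma)) by exact: bmeas_small.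
apply: le_trans (gmean_small_le _); last by rewrite divr_ge0// ltW.
have e : gmean (fun z => Num.sg (x + sigma * z) + Num.sg (x + sigma * - z)) =
    2 * gmean (fun z => Num.sg (x + sigma * z)).
  by rewrite (gmeanD bs bsN) (gmeanN bs) mulr2n mulrDl mul1r.
rewrite -(@ler_pM2l _ 2)// -e -(gmeanZ 2 bm).
apply: le_gmean; [exact: bmeasD|exact: bmeasZ|].
move=> z; rewrite /small.
have -> : (`|z| <= x / sigma) = (`|sigma * z| <= x).
  by rewrite ler_pdivlMr// normrM gtr0_norm// mulrC.
have le1 y : Num.sg y <= 1 :> R.
  by rewrite (le_trans (ler_norm _))// normr_sg; case: eqP.
case: ifPn => [_|]; first by rewrite mulr1 (_ : 2 = 1 + 1 :> R)// lerD.
rewrite -ltNge ltr_normr mulr0 mulrN => /orP[] xs.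
  have -> : Num.sg (x - sigma * z) = -1 by rewrite ltr0_sg// subr_lt0.
  by have := le1 (x + sigma * z); lra.
have -> : Num.sg (x + sigma * z) = -1 by rewrite ltr0_sg//; lra.
by have := le1 (x - sigma * z); lra.
Qed.

(** Split at time [d]: an earlier branching has probability at most [zeta * d], and a later one has
    standard deviation at least [Num.sqrt d] in [gmean_sg_le]. *)
Lemma Emean_sg_le (d x : R) : 0 < d -> 0 <= x ->
  Emean zeta (fun p => Num.sg (x + Num.sqrt p.1 * p.2)) <=
    zeta * d + 2 * normal_peak 1 / Num.sqrt d * x.
Proof.
move=> d0 x0; set C := 2 * normal_peak 1 / Num.sqrt d.
have C0 : 0 <= C by rewrite divr_ge0 ?sqrtr_ge0// mulr_ge0// normal_peak_ge0.
have bs : bmeas (fun p : R * R => Num.sg (x + Num.sqrt p.1 * p.2)).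
  have [ms [c sc]] := bmeas_sg; split; last by exists c.
  apply: measurableT_comp => //; apply: measurable_funD => //.
  apply: measurable_funM => //; apply: measurableT_comp => //.
  by apply: continuous_measurable_fun; exact: sqrt_continuous.
rewrite Emean_fubini//.
pose j (s : R) : R := if s <= d then 0 else 1.
have bj : bmeas j.
  apply: (@bmeas_le _ _ _ 1) => [|s]; last by rewrite /j; case: ifP; rewrite ?normr1 ?normr0.
  by apply: measurable_fun_ifT => //; exact: measurable_fun_ler.
have epdf0 (s : R) : 0 <= exponential_pdf zeta s.
  by apply: exponential_pdf_ge0; exact: ltW.
have mepdf := measurable_exponential_pdf zeta.
have iepdf := integral_exponential_pdf zeta_gt0.
have bk : bmeas (fun s => (C * x + 1) - j s) by apply: bmeasB => //; exact: bmeas_cst.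
(* The majorant is [C * x + 1] up to time [d] and [C * x] after it; its mean is bounded through
   [1 - expR (- zeta * d) <= zeta * d]. *)
apply: (@le_trans _ _ (emean zeta (fun s => (C * x + 1) - j s))); last first.
  rewrite [leLHS]wmeanB//; last exact: bmeas_cst.
  rewrite wmean_cst// -/(emean zeta j) (emean_tail zeta_gt0 (ltW d0)).
  have := expR_ge1Dx (- zeta * d); rewrite -/C; move: (expR _) => e.
  move: (C * x) => q; lra.
apply: le_wmean => //; first exact: (bmeas_gmean bs).
move=> s ws; have s0 : 0 <= s.
  by rewrite leNgt; apply/negP => /lt0_exponential_pdf e; rewrite e ltxx in ws.
rewrite /j; case: (leP s d) => sd /=.
  rewrite subr0 (@le_trans _ _ 1)//; last by rewrite lerDr mulr_ge0.
  rewrite (le_trans (ler_norm _))//; apply: wmean_bound.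
  - exact: measurable_normal_pdf.
  - exact: normal_pdf_ge0.
  - exact: integral_normal_pdf.
  - exact: (bmeas_section s bs).
  - by move=> z; rewrite normr_sg; case: eqP.
rewrite addrK (le_trans (gmean_sg_le _ _))//; first by rewrite sqrtr_gt0 (lt_trans d0).
have -> : C * x = 2 * normal_peak 1 * (x / Num.sqrt d) by rewrite /C; ring.
rewrite ler_wpM2l ?mulr_ge0 ?normal_peak_ge0// ler_wpM2l//.
have s_gt0 : 0 < s by exact: lt_trans sd.
by rewrite lef_pV2 ?posrE ?sqrtr_gt0//; apply: ler_wsqrtr; exact: ltW.
Qed.

End small_ball.

(** * Truncation *)

Section clamp.
Context (R : realType).
Implicit Types a x y z : R.

(** Truncation to [-a, a]: odd, nondecreasing and 1-Lipschitz. It keeps the barriers bounded and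
    extends [F] from [-1, 1] to the whole line. *)
Definition clamp a y : R := Num.max (- a) (Num.min a y).

Lemma clamp_case a y : 0 <= a ->
  [\/ y <= - a /\ clamp a y = - a, - a <= y <= a /\ clamp a y = y |
      a <= y /\ clamp a y = a].
Proof.
move=> a0; rewrite /clamp; case: (leP a y) => ay.
  by apply: Or33; split => //; case: leP => //; lra.
case: (leP (- a) y) => ya; first by apply: Or32; split => //; apply/andP; split; lra.
by apply: Or31; split => //; lra.
Qed.

Lemma clampN a y : 0 <= a -> clamp a (- y) = - clamp a y.
Proof.
move=> a0; case: (clamp_case y a0) => -[h1 ->]; case: (clamp_case (- y) a0) => -[h2 ->];
  lra.
Qed.

Lemma normr_clamp a y : 0 <= a -> `|clamp a y| <= a.
Proof.
by move=> a0; rewrite ler_norml; case: (clamp_case y a0) => -[h1 ->]; apply/andP; split; lra.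
Qed.

Lemma clamp_nd a x y : 0 <= a -> x <= y -> clamp a x <= clamp a y.
Proof.
move=> a0 xy; case: (clamp_case x a0) => -[h1 ->]; case: (clamp_case y a0) => -[h2 ->]; lra.
Qed.

Lemma clamp_lip a x y : 0 <= a -> `|clamp a x - clamp a y| <= `|x - y|.
Proof.
move=> a0; wlog xy : x y / x <= y => [W|].
  have [/W//|/ltW/W] := leP x y; by rewrite distrC [`|y - x|]distrC.
rewrite distrC [`|x - y|]distrC !ger0_norm ?subr_ge0 ?clamp_nd//.
case: (clamp_case x a0) => -[h1 ->]; case: (clamp_case y a0) => -[h2 ->]; lra.
Qed.

Lemma clamp_id a y : `|y| <= a -> clamp a y = y.
Proof.
move=> ya; have a0 : 0 <= a := le_trans (normr_ge0 _) ya.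
by move: ya; rewrite ler_norml => /andP[? ?]; case: (clamp_case y a0) => -[h1 ->]; lra.
Qed.

Lemma clamp_ge0 a y : 0 <= a -> 0 <= y -> 0 <= clamp a y.
Proof. by move=> a0 y0; case: (clamp_case y a0) => -[h1 ->]; lra. Qed.

Lemma clamp_le_id a y : 0 <= a -> 0 <= y -> clamp a y <= y.
Proof. by move=> a0 y0; case: (clamp_case y a0) => -[h1 ->]; lra. Qed.

Lemma clampZ c a y : 0 < c -> clamp (c * a) (c * y) = c * clamp a y.
Proof. by move=> c0; rewrite /clamp maxr_pMr ?minr_pMr ?mulrN// ltW. Qed.

(** The two arguments add up to [2 * x >= 0], so the truncation removes at least as much above [a]
    as it adds below [- a]. *)
Lemma clamp_symm_le a x y : 0 <= a -> 0 <= x -> clamp a (x + y) + clamp a (x - y) <= 2 * x.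
Proof.
by move=> a0 x0; case: (clamp_case (x + y) a0) => -[h1 ->];
  case: (clamp_case (x - y) a0) => -[h2 ->]; lra.
Qed.

(** If [y] is at most [r] in absolute value, neither argument is truncated; otherwise the sum is
    still nonnegative. *)
Lemma clamp_symm_ge a r x y : 0 <= r -> 0 <= x -> x + r <= a ->
  2 * x * small r y <= clamp a (x + y) + clamp a (x - y).
Proof.
move=> r0 x0 xra; have a0 : 0 <= a by lra.
rewrite /small; case: ifPn => [yr|_]; last first.
  rewrite mulr0.
  by case: (clamp_case (x + y) a0) => -[h1 ->]; case: (clamp_case (x - y) a0) => -[h2 ->]; lra.
move: yr; rewrite ler_norml => /andP[y1 y2].
by case: (clamp_case (x + y) a0) => -[h1 ->]; case: (clamp_case (x - y) a0) => -[h2 ->]; lra.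
Qed.

Lemma measurable_clamp a : measurable_fun setT (clamp a).
Proof. by apply: measurable_maxr => //; exact: measurable_minr. Qed.

Lemma bmeas_clamp a : 0 <= a -> bmeas (clamp a).
Proof.
by move=> a0; apply: (@bmeas_le _ _ _ a) => [|y]; [exact: measurable_clamp|exact: normr_clamp].
Qed.

End clamp.

(** * Comparison *)

(** It closes the iterations below, in which an error bound shrinks by a fixed factor at each use of
    the formula. *)
Lemma geometric_null (R : realType) (a C q : R) : 0 <= q < 1 ->
  (forall n, a <= C * q ^+ n) -> a <= 0.
Proof.
move=> /andP[q0 q1] aC.
have c0 : C * q ^+ n @[n --> \oo] --> (C * 0 : R).
  by apply: cvgM; [exact: cvg_cst|apply: cvg_expr; rewrite ger0_norm].
by rewrite mulr0 in c0; apply: (cvgr_to_ge c0); exact: nearW.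
Qed.

Section comparison.
Context (R : realType) (gamma zeta L : R) (G : R -> R) (u : R -> R -> R).
Hypothesis gamma_gt1 : 1 < gamma.
Hypothesis zeta_gt0 : 0 < zeta.
Hypothesis L_ge0 : 0 <= L.
Hypothesis G_odd : forall v, G (- v) = - G v.
Hypothesis G_nd : forall v w, v <= w -> G v <= G w.
Hypothesis G_lip : forall v w, `|G v - G w| <= L * `|v - w|.
Hypothesis G_le1 : forall v, `|G v| <= 1.
Hypothesis mu_ : measurable_fun setT (fun p : R * R => u p.1 p.2).
Hypothesis u_le1 : forall t x, `|u t x| <= 1.

Local Notation E := (Emean zeta).

(** The integrand [K_t] of Duhamel's formula, with [G] in place of [F]. *)
Definition kern t (p : R * R) :=
  if p.1 <= t then G (u (t - p.1) (gamma^-1 * p.2)) else Num.sg p.2.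

Hypothesis uE : forall t x, 0 <= t ->
  u t x = E (fun p => kern t (p.1, x + clock t p.1 * p.2)).

Lemma G_continuous : continuous G.
Proof.
move=> v; apply/cvgrPdist_le => e e0; near=> w.
rewrite (le_trans (G_lip _ _))// (@le_trans _ _ ((L + 1) * `|v - w|))//.
  by rewrite ler_wpM2r// lerDl.
rewrite -ler_pdivlMl ?ltr_pwDr//; near: w.
by apply: cvgr_dist_le; [exact: cvg_id|rewrite mulr_gt0// invr_gt0 ltr_pwDr].
Unshelve. all: by end_near. Qed.

Let mG : measurable_fun setT G := continuous_measurable_fun G_continuous.

Lemma bmeas_kern t : bmeas (kern t).
Proof.
apply: (@bmeas_if _ (fun s y => G (u s (gamma^-1 * y)))); last exact: (@bmeas_sg R).
apply: (@bmeas_le _ _ _ 1) => // ; apply: measurableT_comp => //.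
apply: (measurableT_comp mu_ (g := fun p : R * R => (p.1, gamma^-1 * p.2))).
by apply: measurable_fun_pair => //; exact: measurable_funM.
Qed.

Lemma clock_ge0 (t s : R) : 0 <= clock t s.
Proof. exact: sqrtr_ge0. Qed.

Let mclock (t : R) : measurable_fun setT (clock t) := measurable_clock t.

(** With this rate [L * (zeta / (zeta + lam)) = L / (1 + 2 * L)], which is at most 1/2: the
    Lipschitz constant is absorbed and the error halves at each use of the formula. *)
Let lam := 2 * L * zeta.

Let lam_ge0 : 0 <= lam.
Proof. by rewrite !mulr_ge0// ltW. Qed.

Let Emean_discount_le : L * E (fun p => discount lam p.1) <= 2^-1.
Proof.
rewrite Emean_discount//.
have -> : zeta / (zeta + lam) = (1 + 2 * L)^-1.
  rewrite (_ : zeta + lam = zeta * (1 + 2 * L)); last by rewrite /lam; ring.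
  by rewrite invfM mulVKf ?gt_eqF.
have L1 : 0 < 1 + 2 * L by rewrite ltr_pwDl// mulr_ge0.
rewrite ler_pdivrMr// mulrDr mulr1 mulKf//.
by rewrite lerDr invr_ge0.
Qed.

Let discountE t s : 0 <= s -> expR (lam * t) * discount lam s = expR (lam * (t - s)).
Proof. by move=> s0; rewrite /discount ger0_norm// -expRD; congr expR; ring. Qed.

Let bD := bmeas_discount lam_ge0.

Lemma kern_odd t s y : (forall r x, 0 <= r -> u r (- x) = - u r x) ->
  kern t (s, - y) = - kern t (s, y).
Proof.
move=> uodd; rewrite /kern/=; case: ifPn => [st|_]; last by rewrite sgrN.
by rewrite mulrN uodd ?subr_ge0// G_odd.
Qed.

(** In the sum of the formulas at [x] and [- x] the sign terms cancel, and the Lipschitz bound on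
    the odd [G] returns the defect at earlier times. Each use of the formula thus halves a bound of
    the form [k * expR (lam * t)]. *)
Lemma mild_odd t x : 0 <= t -> u t (- x) = - u t x.
Proof.
have H n r y : 0 <= r -> `|u r y + u r (- y)| <= 2 * 2^-1 ^+ n * expR (lam * r).
  elim: n r y => [|n IH] r y r0.
    rewrite expr0 mulr1 (le_trans (ler_normD _ _))//.
    rewrite (_ : 2 = 1 + 1 :> R)// mulrDl mul1r.
    have e1 : 1 <= expR (lam * r) by rewrite -expR0 ler_expR mulr_ge0.
    by rewrite lerD// (le_trans (u_le1 _ _)).
  have bk := bmeas_kern r.
  have bkN : bmeas (fun p : R * R => kern r (p.1, - p.2)).
    have [mk [C kC]] := bk; split; last by exists C.
    apply: (measurableT_comp mk (g := fun p : R * R => (p.1, - p.2))).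
    by apply: measurable_fun_pair => //; exact: measurableT_comp.
  have -> : u r (- y) = E (fun p => kern r (p.1, - (y + clock r p.1 * p.2))).
    rewrite uE// -(Emean_walkN zeta_gt0 (- y) (mclock r) bk).
    by congr (E _); apply/funext => p; rewrite opprD.
  rewrite uE// -(EmeanD zeta_gt0 (bmeas_walk1 y (mclock r) bk)
    (bmeas_walk1 y (mclock r) bkN)).
  pose k := 2 * 2^-1 ^+ n : R.
  have k0 : 0 <= k by rewrite mulr_ge0// exprn_ge0// invr_ge0.
  pose M := L * k * expR (lam * r).
  have M0 : 0 <= M by rewrite !mulr_ge0// expR_ge0.
  (* The previous bound at time [r - s] is the source of the discount. *)
  have key s z : 0 <= s -> `|kern r (s, z) + kern r (s, - z)| <= M * discount lam s.
    move=> s0; rewrite /kern/=; case: ifPn => sr; last first.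
      by rewrite sgrN subrr normr0 mulr_ge0// expR_ge0.
    rewrite -[X in _ + X]opprK -G_odd (le_trans (G_lip _ _))// opprK mulrN.
    by rewrite /M -mulrA discountE// -mulrA ler_wpM2l// IH// subr_ge0.
  have : E (fun p => M * discount lam p.1) <= 2 * 2^-1 ^+ n.+1 * expR (lam * r).
    rewrite EmeanZ// /M exprS; move: (expR_ge0 (lam * r)) Emean_discount_le.
    rewrite -/k => e0 hd; rewrite (_ : 2 * (2^-1 * 2^-1 ^+ n) = k * 2^-1); last first.
      by rewrite /k; ring.
    set e := expR _ in e0 *; set d := E _ in hd *.
    have -> : L * k * e * d = (k * e) * (L * d) by ring.
    have -> : k * 2^-1 * e = (k * e) * 2^-1 by ring.
    by rewrite ler_wpM2l// mulr_ge0.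
  apply: le_trans; rewrite ler_norml -EmeanN//; last exact: bmeasZ.
  have bs := bmeasD (bmeas_walk1 y (mclock r) bk) (bmeas_walk1 y (mclock r) bkN).
  apply/andP; split; apply: le_Emean => //; try exact: bmeasN (bmeasZ _ _); try exact: bmeasZ.
    by move=> s z s0 /=; have := key s (y + clock r s * z) s0; rewrite ler_norml => /andP[].
  by move=> s z s0 /=; have := key s (y + clock r s * z) s0; rewrite ler_norml => /andP[].
move=> t0; apply/eqP; rewrite -addr_eq0 addrC -normr_le0.
apply: (@geometric_null _ _ (2 * expR (lam * t)) 2^-1); first lra.
by move=> n; rewrite mulrAC; exact: H.
Qed.

Lemma G0 : G 0 = 0.
Proof. by have := G_odd 0; rewrite oppr0; lra. Qed.

(** * The limit profile: stationarity and the two barriers *)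

Section limit_profile.
Context (U : R -> R).
Hypothesis u_lim : forall x, u t x @[t --> +oo] --> U x.

(** Integer times give access to sequential results: measurability of pointwise limits and dominated
    convergence. *)
Let u_nat x : u n%:R x @[n --> \oo] --> U x.
Proof.
apply: (@cvg_comp _ _ _ (fun n : nat => n%:R : R) (fun t => u t x)); last exact: u_lim.
exact: cvgr_idn.
Qed.

Lemma U_le1 x : `|U x| <= 1.
Proof.
have cn : `|u n%:R x| @[n --> \oo] --> `|U x| by apply: cvg_norm; exact: (@u_nat _).
apply: (cvgr_to_le cn).
by apply: nearW => n; exact: u_le1.
Qed.

Lemma bmeas_U : bmeas U.
Proof.
apply: (@bmeas_le _ _ _ 1) => [|x].
  apply: (measurable_fun_cvg (h := fun n => u n%:R)) => [n|y _]; last exact: (@u_nat _).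
  exact: (measurable_fun_pair2 _ mu_).
exact: U_le1.
Qed.

Lemma U_odd x : U (- x) = - U x.
Proof.
have cN : u n%:R (- x) @[n --> \oo] --> - U x.
  rewrite (_ : (fun n : nat => _) = fun n : nat => - u n%:R x).
    by apply: cvgN; exact: (@u_nat _).
  by apply/funext => n; rewrite mild_odd.
exact: (cvg_unique _ (@u_nat (- x)) cN).
Qed.

Let bGU : bmeas (fun p : R * R => G (U (gamma^-1 * p.2))).
Proof.
apply: (@bmeas_le _ _ _ 1) => //; apply: measurableT_comp => //.
have [mU _] := bmeas_U.
by apply: (measurableT_comp mU); exact: measurable_funM.
Qed.

Let msqrt : measurable_fun setT (Num.sqrt : R -> R).
Proof. by apply: continuous_measurable_fun; exact: sqrt_continuous. Qed.

(** Pass to the limit in the formula by dominated convergence: for fixed [s] and [n >= s] the kernel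
    involves [G] of [u] at time [n - s], and the clock is [Num.sqrt s]. *)
Lemma stationary x : U x = E (fun p => G (U (gamma^-1 * (x + Num.sqrt p.1 * p.2)))).
Proof.
apply: (cvg_unique _ (@u_nat x)) => //.
rewrite (_ : (fun n : nat => _) =
    fun n : nat => E (fun p => kern n%:R (p.1, x + clock n%:R p.1 * p.2))); last first.
  by apply/funext => n; rewrite uE.
apply: (@cvg_Emean _ _ zeta_gt0 1).
- by move=> n; have [] := bmeas_walk1 x (mclock n%:R) (bmeas_kern n%:R).
- by have [] := bmeas_walk1 x msqrt bGU.
- move=> n p; rewrite /kern; case: ifP => _ //=.
  by rewrite normr_sg; case: eqP.
move=> s z s0 /=; set y := _ * _.
have : G (u (n%:R - s) y) @[n --> \oo] --> G (U y).
  apply: (@cvg_comp _ _ _ (fun n : nat => u (n%:R - s) y) G _ (nbhs (U y))); last exact: G_continuous.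
  have ns : n%:R - s @[n --> \oo] --> +oo.
    apply: (@cvg_comp _ _ _ (fun n : nat => n%:R : R) (fun t => t - s)); last exact: cvg_addrr.
    exact: cvgr_idn.
  by apply: (@cvg_comp _ _ _ (fun n : nat => n%:R - s) (fun t => u t y)); last exact: u_lim.
apply: cvg_trans; apply: near_eq_cvg; near=> n.
have sn : s <= n%:R by near: n; exact: nbhs_infty_ger.
by rewrite /kern/= sn /clock min_l.
Unshelve. all: by end_near. Qed.

Lemma bmeas_snd (f : R -> R) : bmeas f -> bmeas (fun p : R * R => f p.2).
Proof.
by move=> [mf [C fC]]; split; [exact: measurableT_comp|exists C].
Qed.

Lemma Emean_clamp_le A x : 0 <= A -> 0 <= x ->
  E (fun p => clamp 1 (A * (x + Num.sqrt p.1 * p.2))) <= A * x.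
Proof.
move=> A0 x0.
have bh : bmeas (fun p : R * R => clamp 1 (A * p.2)).
  apply: (@bmeas_snd (fun y => clamp 1 (A * y))).
  have [mc [C cC]] := @bmeas_clamp R 1 ler01; split; last by exists C.
  by apply: measurableT_comp => //; exact: measurable_funM.
rewrite (Emean_symm zeta_gt0 x msqrt bh)/= -[leRHS](@mulKf _ 2)// ler_pM2l ?invr_gt0//.
rewrite -[leRHS](Emean_cst zeta_gt0); apply: le_Emean => //.
- by apply: bmeasD; [exact: (bmeas_walk1 x msqrt bh)|exact: (bmeas_walkN x msqrt bh)].
- exact: bmeas_cst.
by move=> s z s0 /=; rewrite mulrDr mulrBr clamp_symm_le// mulr_ge0.
Qed.

(** The bound [(K * x + 1) * rho ^+ n] for [x >= 0] gains one power of [rho] at each use of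
    [stationary]; oddness gives the other half-line. *)
Lemma U_vanish (Y : R) : 0 <= Y -> Y < gamma ->
  (forall v, `|v| <= 1 -> `|G v| <= Y * `|v|) -> forall x, U x = 0.
Proof.
move=> Y0 Yg GY; have g0 : 0 < gamma := lt_trans ltr01 gamma_gt1.
pose q := Y / gamma; have q0 : 0 <= q by rewrite divr_ge0// ltW.
have q1 : q < 1 by rewrite ltr_pdivrMr// mul1r.
(* Midway between [q] and 1, so that [q < rho < 1] and also [1 / 2 <= rho]. *)
pose rho := (1 + q) / 2.
have rhoq : 0 < rho - q by rewrite /rho; lra.
(* So small that [Y * (zeta * d) = Y / (2 * (Y + 1))] is below 1/2; this is the factor picked up by
   the constant part of the bound. *)
pose d := (2 * zeta * (Y + 1))^-1.
have d0 : 0 < d by rewrite invr_gt0 !mulr_gt0//; lra.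
have Yd : Y * (zeta * d) <= rho.
  have -> : Y * (zeta * d) = Y / (2 * (Y + 1)).
    by rewrite /d; field; rewrite !gt_eqF//; lra.
  by rewrite ler_pdivrMr; [rewrite /rho; nra|lra].
pose C := 2 * normal_peak 1 / Num.sqrt d.
have C0 : 0 <= C by rewrite divr_ge0 ?sqrtr_ge0// mulr_ge0// normal_peak_ge0.
(* Solves [q * K + Y * C = rho * K]: the slope [Y * C] created by the mean sign is absorbed in the
   linear part. *)
pose K := Y * C / (rho - q).
have K0 : 0 <= K by apply: divr_ge0; [exact: mulr_ge0|exact: ltW].
have KE : q * K + Y * C = rho * K by rewrite /K; field; rewrite gt_eqF.
have bH : bmeas (fun p : R * R => G (U (gamma^-1 * p.2))) := bGU.
suff H n x : 0 <= x -> `|U x| <= (K * x + 1) * rho ^+ n.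
  have U0 x : 0 <= x -> U x = 0.
    move=> x0; apply/eqP; rewrite -normr_le0.
    apply: (@geometric_null _ _ (K * x + 1) rho); first by rewrite /rho; apply/andP; split; lra.
    by move=> n; exact: H.
  move=> x; have [/U0//|/ltW x0] := leP 0 x.
  by rewrite -(opprK x) U_odd U0 ?oppr0// oppr_ge0.
elim: n x => [|n IH] x x0.
  by rewrite expr0 mulr1 (le_trans (U_le1 x))// lerDr mulr_ge0.
set k := rho ^+ n in IH *.
have k0 : 0 <= k by rewrite exprn_ge0// /rho; lra.
pose A := q * k * K; have A0 : 0 <= A by apply: mulr_ge0 => //; exact: mulr_ge0.
pose B := Y * k; have B0 : 0 <= B by exact: mulr_ge0.
(* An odd barrier for [G (U (y / gamma))]. Its linear part may be truncated at 1 because [G] is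
   bounded by 1; its constant part is carried by the sign. *)
pose b (y : R) := clamp 1 (A * y) + B * Num.sg y.
have bb : bmeas b.
  apply: bmeasD; last by apply: bmeasZ; exact: bmeas_sg.
  have [mc [D cD]] := @bmeas_clamp R 1 ler01; split; last by exists D.
  by apply: measurableT_comp => //; exact: measurable_funM.
have bodd y : b (- y) = - b y by rewrite /b mulrN clampN// sgrN mulrN opprD.
have Hb y : 0 <= y -> `|G (U (gamma^-1 * y))| <= b y.
  rewrite le_eqVlt => /predU1P[<-|y0].
    have U00 : U 0 = 0 by have := U_odd 0; rewrite oppr0; lra.
    by rewrite /b !mulr0 U00 G0 normr0 sgr0 mulr0 addr0 clamp_ge0.
  rewrite /b gtr0_sg// mulr1.
  have h1 : `|G (U (gamma^-1 * y))| <= A * y + B.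
    rewrite (le_trans (GY _ (U_le1 _)))//.
    have -> : A * y + B = Y * ((K * (gamma^-1 * y) + 1) * k).
      by rewrite /A /B /q; ring.
    by apply: ler_wpM2l => //; apply: IH; apply: mulr_ge0; rewrite ?invr_ge0 ltW.
  have h2 := G_le1 (U (gamma^-1 * y)).
  have Ay : 0 <= A * y by rewrite mulr_ge0// ltW.
  by case: (clamp_case (A * y) (@ler01 R)) => -[h3 ->]; lra.
have bE : E (fun p => b (x + Num.sqrt p.1 * p.2)) <= (K * x + 1) * rho ^+ n.+1.
  have bc : bmeas (fun p : R * R => clamp 1 (A * (x + Num.sqrt p.1 * p.2))).
    apply: (bmeas_walk1 (h := fun p => clamp 1 (A * p.2)) x msqrt).
    apply: (@bmeas_snd (fun y => clamp 1 (A * y))).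
    have [mc [D cD]] := @bmeas_clamp R 1 ler01; split; last by exists D.
    by apply: measurableT_comp => //; exact: measurable_funM.
  have bs : bmeas (fun p : R * R => Num.sg (x + Num.sqrt p.1 * p.2)).
    exact: (bmeas_walk1 (h := fun p => Num.sg p.2) x msqrt (bmeas_snd (@bmeas_sg R))).
  rewrite /b EmeanD//; last exact: bmeasZ.
  rewrite EmeanZ//.
  have c1 := Emean_clamp_le A0 x0.
  have c2 := ler_wpM2l B0 (Emean_sg_le zeta_gt0 d0 x0).
  apply: (le_trans (lerD c1 c2)); rewrite exprS -/k -/C.
  have -> : (K * x + 1) * (rho * k) = (rho * K) * k * x + rho * k by ring.
  rewrite -KE /A /B.
  have := ler_wpM2r k0 Yd; nra.
have bbE : bmeas (fun p : R * R => b (x + Num.sqrt p.1 * p.2)).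
  exact: (bmeas_walk1 (h := fun p => b p.2) x msqrt (bmeas_snd bb)).
have bHE := bmeas_walk1 x msqrt bH.
(* The sum and the difference of the barrier and [G (U (y / gamma))] are both odd and nonnegative on
   the half-line. *)
apply: le_trans bE; rewrite ler_norml; apply/andP; split.
- rewrite -subr_ge0 opprK (stationary x) -EmeanD//.
  apply: (@Emean_odd_ge0 _ _ zeta_gt0 (fun p => G (U (gamma^-1 * p.2)) + b p.2)) => //.
  + by apply: bmeasD => //; exact: bmeas_snd.
  + by move=> s y _ /=; rewrite mulrN U_odd G_odd bodd; ring.
  + by move=> s y _ /= /Hb; rewrite ler_norml => /andP[]; lra.
- rewrite -subr_ge0 (stationary x) -EmeanB//.
  apply: (@Emean_odd_ge0 _ _ zeta_gt0 (fun p => b p.2 - G (U (gamma^-1 * p.2)))) => //.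
  + by apply: bmeasB => //; exact: bmeas_snd.
  + by move=> s y _ /=; rewrite mulrN U_odd G_odd bodd; ring.
  + by move=> s y _ /= /Hb; rewrite ler_norml => /andP[]; lra.
Qed.

Let bsmall r : bmeas (fun p : R * R => small r (Num.sqrt p.1 * p.2)).
Proof. by apply: bmeas_small; apply: measurable_funM => //; exact: measurableT_comp. Qed.

(** As the radius grows the indicators tend to 1 pointwise, and dominated convergence applies. *)
Lemma large_ball (c : R) : c < 1 ->
  exists2 r, 0 < r & c <= E (fun p => small r (Num.sqrt p.1 * p.2)).
Proof.
move=> c1.
have cv : E (fun p => small n%:R (Num.sqrt p.1 * p.2)) @[n --> \oo] --> E (fun=> 1).
  apply: (@cvg_Emean _ _ zeta_gt0 1) => //.
  - by move=> n; have [] := bsmall n%:R.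
  - by move=> n p; rewrite /small; case: ifP; rewrite ?normr1 ?normr0.
  move=> s z _ /=; apply: cvg_near_cst; near=> n.
  by rewrite /small ifT//; near: n; exact: nbhs_infty_ger.
rewrite Emean_cst// in cv.
have [n _ Hn] := cvgr_ge _ cv _ c1.
by exists n.+1%:R => //; apply: (Hn n.+1) => /=.
Unshelve. all: by end_near. Qed.

(** From the start [clamp N x <= N], displacements of size at most [r] escape the truncation at
    [N + r] and cancel with their opposites. Since [clock t s <= Num.sqrt s], one radius serves all
    [t]. *)
Lemma Emean_clamp_ge t x N r : 0 <= N -> 0 <= r -> 0 <= x ->
  clamp N x * E (fun p => small r (Num.sqrt p.1 * p.2)) <=
  E (fun p => clamp (N + r) (x + clock t p.1 * p.2)).
Proof.
move=> N0 r0 x0; set x' := clamp N x.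
have x'0 : 0 <= x' by exact: clamp_ge0.
have x'x : x' <= x by exact: clamp_le_id.
have x'N : x' <= N by have := normr_clamp x N0; rewrite -/x' ler_norml => /andP[].
have Nr : 0 <= N + r by rewrite addr_ge0.
have bc : bmeas (fun p : R * R => clamp (N + r) p.2).
  exact: (bmeas_snd (bmeas_clamp Nr)).
have bcx y := bmeas_walk1 y (mclock t) bc.
apply: (@le_trans _ _ (E (fun p => clamp (N + r) (x' + clock t p.1 * p.2)))); last first.
  apply: le_Emean; [by []|exact: bcx|exact: bcx|].
  by move=> s z _ /=; rewrite clamp_nd// lerD2r.
rewrite (Emean_symm zeta_gt0 x' (mclock t) bc) ler_pdivlMl// mulrA -EmeanZ//.
apply: le_Emean => //.
- exact: bmeasZ.
- by apply: bmeasD; [exact: bcx|exact: (bmeas_walkN x' (mclock t) bc)].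
move=> s z s0 /=; apply: le_trans (clamp_symm_ge _ r0 x'0 _); last by rewrite lerD2r.
rewrite ler_wpM2l ?mulr_ge0// /small; case: ifP => // h1; last by case: ifP.
rewrite ifT// (le_trans _ h1)// !normrM ler_wpM2r// !ger0_norm ?sqrtr_ge0//.
by apply: ler_wsqrtr; rewrite ge_min lexx.
Qed.

(** The barrier [e * clamp N] reproduces itself: nonlinearity and scaling turn it into
    [b * e / gamma] times [clamp (N + r)], and diffusion costs at most the factor [gamma / b]. *)
Lemma u_barrier (b v0 : R) : gamma < b -> 0 < v0 <= 1 ->
  (forall v, 0 <= v <= v0 -> b * v <= G v) ->
  exists2 e, 0 < e <= 1 & exists X, forall t x, 0 <= t -> X <= x -> e <= u t x.
Proof.
move=> gb /andP[v00 v01] Gb.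
have g0 : 0 < gamma := lt_trans ltr01 gamma_gt1.
have b0 : 0 < b := lt_trans g0 gb.
have [|r r0 Hr] := @large_ball (gamma / b); first by rewrite ltr_pdivrMr// mul1r.
(* Chosen so that [gamma * N = N + r]: scaling space by [gamma] makes up for the loss [r] in the
   truncation level. *)
pose N := r / (gamma - 1).
have g10 : 0 < gamma - 1 by rewrite subr_gt0.
have N0 : 0 < N by rewrite divr_gt0.
have gN : gamma * N = N + r by rewrite /N; field; rewrite gt_eqF.
(* Makes [b * (e * N) = v0]: the barrier stays where [b * v <= G v] holds, and [b] times it stays
   below the value 1 of the sign. *)
pose e := v0 / (b * N).
have e0 : 0 < e by rewrite divr_gt0// mulr_gt0.
have beN : b * (e * N) = v0 by rewrite /e; field; rewrite !gt_eqF.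
have eN0 : 0 < e * N by rewrite mulr_gt0.
have eN : e * N <= v0.
  by rewrite -beN ler_peMl ?(ltW eN0)// ltW// (lt_trans gamma_gt1).
suff main t x : 0 <= t -> 0 <= x -> e * clamp N x <= u t x.
  exists (e * N); first by apply/andP; split; lra.
  exists N => t x t0 Nx; have x0 : 0 <= x by lra.
  have := main t x t0 x0.
  have -> // : clamp N x = N.
  by case: (clamp_case x (ltW N0)) => -[h1 ->] //; lra.
(* The barrier holds up to an error that halves with [n]; the case [n = 0] is the trivial bound by
   2. *)
suff H n s y : 0 <= s -> 0 <= y ->
    e * clamp N y - 2 * 2^-1 ^+ n * expR (lam * s) <= u s y.
  move=> t0 x0; rewrite -subr_le0.
  apply: (@geometric_null _ _ (2 * expR (lam * t)) 2^-1); first lra.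
  by move=> n; have := H n t x t0 x0; rewrite mulrAC; lra.
have clb z : 0 <= z -> 0 <= e * clamp N z <= v0.
  move=> z0; rewrite mulr_ge0 ?clamp_ge0// ?(ltW e0) ?(ltW N0)//=.
  have := normr_clamp z (ltW N0); rewrite ler_norml => /andP[_ h].
  by rewrite (le_trans _ eN)// ler_wpM2l// ltW.
elim: n s y => [|n IH] s y s0 y0.
  have := u_le1 s y; rewrite ler_norml => /andP[h1 _].
  have h2 : 1 <= expR (lam * s) by rewrite -expR0 ler_expR mulr_ge0.
  have /andP[_ h3] := clb y y0.
  by rewrite expr0 mulr1; lra.
pose k : R := 2 * 2^-1 ^+ n.
have k0 : 0 <= k by rewrite mulr_ge0// exprn_ge0// invr_ge0.
pose M := L * k * expR (lam * s).
have M0 : 0 <= M by apply: mulr_ge0; [exact: mulr_ge0|exact: expR_ge0].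
pose a := b * e / gamma.
have a0 : 0 <= a by apply: divr_ge0; [apply: mulr_ge0|]; exact: ltW.
have bk := bmeas_kern s.
have bcl : bmeas (fun p : R * R => clamp (N + r) p.2).
  by apply: bmeas_snd; apply: bmeas_clamp; lra.
have bdsg : bmeas (fun p : R * R => discount lam p.1 * Num.sg p.2).
  by apply: bmeasM => //; exact: (bmeas_snd (@bmeas_sg R)).
(* The error is given the sign of the position, which makes the whole expression odd; its
   nonnegativity is then checked for [z >= 0]. *)
pose h p := kern s p - a * clamp (N + r) p.2 + M * (discount lam p.1 * Num.sg p.2).
have bh : bmeas h by apply: bmeasD; [apply: bmeasB => //|]; exact: bmeasZ.
have hodd q z : h (q, - z) = - h (q, z).
  rewrite /h kern_odd; last exact: mild_odd.
  by rewrite /= clampN ?sgrN; [ring|lra].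
have h0 q z : 0 <= q -> 0 <= z -> 0 <= h (q, z).
  move=> q0; rewrite le_eqVlt => /predU1P[<-|z0].
    by have := hodd q 0; rewrite oppr0; lra.
  have z0' := ltW z0.
  rewrite /h /= gtr0_sg// mulr1 /kern /=; case: ifPn => [qs|_]; last first.
    have D0 : 0 <= M * discount lam q by rewrite mulr_ge0// expR_ge0.
    rewrite gtr0_sg// addr_ge0// subr_ge0.
    have /andP[_ hc] : - (N + r) <= clamp (N + r) z <= N + r.
      by rewrite -ler_norml normr_clamp//; lra.
    apply: (le_trans (ler_wpM2l a0 hc)); rewrite -gN /a.
    have -> // : b * e / gamma * (gamma * N) = v0.
    by rewrite -beN; field; rewrite gt_eqF.
  have gz : 0 <= gamma^-1 * z by rewrite mulr_ge0// invr_ge0 ltW.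
  have sq : 0 <= s - q by rewrite subr_ge0.
  have := IH _ _ sq gz; rewrite -/k; set c := e * clamp N _; set w := u _ _ => hw.
  have /Gb hc := clb _ gz.
  have -> : M * discount lam q = L * (k * expR (lam * (s - q))).
    by rewrite /M -discountE//; ring.
  set kap := k * _ in hw *.
  have kap0 : 0 <= kap by rewrite mulr_ge0// expR_ge0.
  have ac : a * clamp (N + r) z = b * c.
    have := clampZ N (gamma^-1 * z) g0; rewrite mulVKf ?gt_eqF// gN => ->.
    by rewrite /a /c; field; rewrite gt_eqF.
  rewrite ac.
  (* Monotonicity carries the induction hypothesis through [G], and the Lipschitz bound turns its
     error [kap] into [L * kap]. *)
  have h1 := G_nd hw; have := G_lip c (c - kap).
  rewrite subKr (ger0_norm kap0) ler_norml => /andP[_ h2].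
  by rewrite -/c in hc; lra.
have := Emean_odd_ge0 zeta_gt0 (mclock s) (clock_ge0 s) bh (fun q z _ => hodd q z) h0 y0.
have bkw := bmeas_walk1 y (mclock s) bk.
have bcw := bmeas_walk1 y (mclock s) bcl.
have bdw := bmeas_walk1 y (mclock s) bdsg.
rewrite /h EmeanD//; [|by apply: bmeasB => //; exact: bmeasZ|exact: bmeasZ].
rewrite EmeanB//; last exact: bmeasZ.
rewrite !EmeanZ//= -uE//.
have d1 : E (fun p => discount lam p.1 * Num.sg (y + clock s p.1 * p.2)) <=
    E (fun p => discount lam p.1).
  apply: le_Emean => // q z _ /=; rewrite ler_piMr ?expR_ge0//.
  by rewrite (le_trans (ler_norm _))// normr_sg; case: eqP.
have d2 : M * E (fun p => discount lam p.1) <= k * 2^-1 * expR (lam * s).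
  rewrite (_ : M * _ = k * expR (lam * s) * (L * E (fun p => discount lam p.1))).
    by rewrite [leRHS]mulrAC ler_wpM2l// mulr_ge0// expR_ge0.
  by rewrite /M; ring.
have d3 := ler_wpM2l M0 d1.
have d4 := Emean_clamp_ge s (ltW N0) (ltW r0) y0.
have d5 : clamp N y * (gamma / b) <= E (fun p => clamp (N + r) (y + clock s p.1 * p.2)).
  by apply: le_trans d4; rewrite ler_wpM2l// clamp_ge0// ltW.
have d6 := ler_wpM2l a0 d5.
(* The gain [b / gamma] contained in [a] and the loss [gamma / b] cancel exactly. *)
have d7 : a * (clamp N y * (gamma / b)) = e * clamp N y.
  by rewrite /a; field; rewrite !gt_eqF.
have -> : 2 * 2^-1 ^+ n.+1 * expR (lam * s) = k * 2^-1 * expR (lam * s).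
  by rewrite exprS /k; ring.
rewrite d7 in d6; lra.
Qed.

(** Take for [l] the supremum of the asymptotic lower bounds of [U]. One generation turns such a
    bound [c] into [G c] up to an arbitrarily small loss, so [G c <= l], and continuity gives
    [G l <= l]. *)
Lemma limit_fixpoint_bound (b v0 : R) : gamma < b -> 0 < v0 <= 1 ->
  (forall v, 0 <= v <= v0 -> b * v <= G v) ->
  exists l, [/\ 0 < l <= 1, G l <= l &
    forall c, c < l -> exists X, forall x, X <= x -> c <= U x].
Proof.
move=> gb hv0 Gb; have [e /andP[e0 e1] [X uX]] := u_barrier gb hv0 Gb.
have g0 : 0 < gamma := lt_trans ltr01 gamma_gt1.
pose S := [set c : R | 0 <= c <= 1 /\ exists X, forall x, X <= x -> c <= U x].
have Se : S e.
  split; first by rewrite (ltW e0).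
  exists X => x Xx; have ulx := @u_lim x; apply: (cvgr_to_ge ulx); near=> t.
  by apply: uX => //; near: t; exact: nbhs_pinfty_ge.
have supS : has_sup S by split; [exists e|exists 1 => c [/andP[]]].
have Sl c : S c -> c <= sup S by move=> Sc; exact: sup_upper_bound.
have l0 : 0 < sup S by apply: lt_le_trans e0 (Sl _ Se).
have l1 : sup S <= 1 by apply: ge_sup; [exists e|move=> c [/andP[]]].
have GS c : S c -> G c <= sup S.
  move=> [/andP[c0 c1] [Y UY]].
  apply/ler_addgt0Pr => eta eta0.
  (* If [G c <= eta] the claim follows from [0 < sup S]; otherwise [G c - eta] is positive, as
     membership in [S] demands. *)
  have [eG|Ge] := leP (G c) eta; first lra.
  rewrite -lerBlDr; apply: Sl; split.
    have := G_le1 c; rewrite ler_norml => /andP[_ h]; apply/andP; split; lra.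
  have [|r r0 Hr] := @large_ball (1 - eta / 2); first lra.
  (* From here a displacement of at most [r] lands beyond [gamma * Y], where the integrand is at
     least [G c]. Other displacements contribute at least -1, at a total cost of at most
     [(G c + 1) * (eta / 2) <= eta]. *)
  exists (gamma * Y + r) => x Yx; rewrite (stationary x).
  pose q := (G c + 1).
  have Gc1 : -1 <= G c <= 1 by rewrite -ler_norml.
  apply: (@le_trans _ _ (E (fun p => q * small r (Num.sqrt p.1 * p.2) + -1))).
    rewrite EmeanD//; [|exact: bmeasZ|exact: bmeas_cst].
    rewrite EmeanZ// Emean_cst// /q.
    have := ler_wpM2l (_ : 0 <= G c + 1) Hr; nra.
  apply: le_Emean => //.
  - by apply: bmeasD; [exact: bmeasZ|exact: bmeas_cst].
  - exact: (bmeas_walk1 x msqrt bGU).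
  move=> s z s0 /=; have := G_le1 (U (gamma^-1 * (x + Num.sqrt s * z))).
  rewrite ler_norml => /andP[h1 h2]; rewrite /small; case: ifPn => [zr|_].
    rewrite /q mulr1 addrK; apply: G_nd; apply: UY.
    rewrite ler_pdivlMl//; move: zr; rewrite ler_norml => /andP[]; lra.
  by rewrite mulr0 add0r.
exists (sup S); split; first by rewrite l0.
  apply/ler_addgt0Pr => d d0.
  have L1 : 0 < L + 1 by rewrite ltr_wpDl.
  have dL : 0 < d / (L + 1) by rewrite divr_gt0.
  (* The supremum may not be attained, so a nearby member is used; [L + 1] keeps the divisor
     positive when [L = 0]. *)
  have [c Sc hc] := sup_adherent dL supS.
  have h1 := GS _ Sc; have h2 := Sl _ Sc; have := G_lip (sup S) c.
  rewrite ler_norml [X in L * X]ger0_norm ?subr_ge0// => /andP[_ h3].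
  have h4 : (L + 1) * (sup S - c) <= d.
    by rewrite -ler_pdivlMl// mulrC; lra.
  have h5 : L * (sup S - c) <= (L + 1) * (sup S - c).
    by rewrite ler_wpM2r ?subr_ge0// lerDl.
  lra.
move=> c cl; have cl0 : 0 < sup S - c by rewrite subr_gt0.
have [c' [_ [Y UY]] hc] := sup_adherent cl0 supS.
by exists Y => x Yx; apply: le_trans (UY _ Yx); lra.
Unshelve. all: by end_near. Qed.

End limit_profile.

End comparison.

(** * The theorem *)

(** Points of opposite signs are compared through 0: their absolute values add up to their distance,
    so the constant is unchanged. *)
Lemma odd_lipschitz (R : realType) (f : R -> R) (L : R) (b : R) : 0 <= b ->
  (forall v, -b <= v <= b -> f (- v) = - f v) ->
  (forall x y, 0 <= x <= b -> 0 <= y <= b -> `|f x - f y| <= L * `|x - y|) ->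
  forall x y, -b <= x <= b -> -b <= y <= b -> `|f x - f y| <= L * `|x - y|.
Proof.
move=> b0 fodd fL x y.
have i0 : 0 <= (0 : R) <= b by rewrite lexx.
have f0 : f 0 = 0.
  by have := fodd 0; rewrite oppr0 oppr_le0 b0 => /(_ isT); lra.
wlog xy : x y / x <= y => [W|] hx hy.
  by have [xy|/ltW xy] := leP x y; [exact: W|rewrite distrC [`|x - y|]distrC; exact: W].
have [/andP[x1 x2] /andP[y1 y2]] := (hx, hy).
have [x0|/ltW x0] := leP 0 x; first by apply: fL; apply/andP; split; lra.
have ix : 0 <= - x <= b by apply/andP; split; lra.
have [y0|/ltW y0] := leP y 0.
  have iy : 0 <= - y <= b by apply/andP; split; lra.
  by have := fL _ _ ix iy; rewrite !fodd// -!opprD !normrN.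
have iy : 0 <= y <= b by apply/andP; split; lra.
have := fL _ _ ix i0; have := fL _ _ iy i0; rewrite fodd// f0 !subr0 !normrN => hy' hx'.
rewrite (le_trans (ler_normB _ _))// (le_trans (lerD hx' hy'))//.
by rewrite -mulrDr distrC (ler0_norm x0) (ger0_norm y0) ger0_norm ?subr_ge0// addrC.
Qed.

(** The infimum over a half-line where [f] is at least [l - e] competes in the supremum defining
    [limf_einf]. *)
Lemma le_limf_einf_pinfty (R : realType) (f : R -> R) (l : R) :
  (forall c, c < l -> exists X, forall x, X <= x -> c <= f x) ->
  (l%:E <= limf_einf (fun x => (f x)%:E) (pinfty_nbhs R))%E.
Proof.
move=> H; apply/lee_subgt0Pr => e e0.
have [X HX] : exists X, forall x, X <= x -> l - e <= f x by apply: H; rewrite ltrBlDr ltrDl.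
rewrite limf_einfE; apply: le_ereal_sup_tmp.
exists (ereal_inf ((fun x => (f x)%:E) @` [set x | X <= x])).
  by exists [set x | X <= x] => //; apply: nbhs_pinfty_ge; exact: num_real.
by apply: le_ereal_inf_tmp => _ [x Xx <-]; rewrite -EFinB lee_fin HX.
Qed.

Lemma duhamel_kern (R : realType) (gamma zeta : R) (G : R -> R) (w : R -> R -> R)
    (t x : R) : 0 < zeta -> 0 <= t -> bmeas (fun p : R * R => G (w p.1 (gamma^-1 * p.2))) ->
  killed_heat zeta t Num.sg x + zeta * \int[@lebesgue_measure R]_(s in `[0, t])
    killed_heat zeta (t - s) (fun y => G (w s (gamma^-1 * y))) x =
  Emean zeta (fun p => kern gamma G w t (p.1, x + clock t p.1 * p.2)).
Proof.
move=> zeta0 t0 bv.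
exact: (@duhamel_Emean R zeta zeta0 (fun s y => G (w s (gamma^-1 * y))) Num.sg t x t0 bv
  (@bmeas_sg R)).
Qed.

Theorem theorem1p4 (R : realType) (gamma zeta : R) (p : nat -> R)
    (eta : nat -> nat -> R) (u : R -> R -> R) (Uoo : R -> R)
    (gamma_gt1 : 1 < gamma) (zeta_gt0 : 0 < zeta)
    (p_ge0 : forall n, (1 <= n)%N -> 0 <= p n)
    (p_sum1 : \sum_(1 <= n < N) p n @[N --> \oo] --> (1 : R))
    (eta_ge0 : forall n k, (1 <= k <= n)%N -> 0 <= eta n k)
    (eta_sum1 : forall n, (1 <= n)%N -> \sum_(1 <= k < n.+1) eta n k = 1)
    (F_C2 : C2_on `[0, 1] (voteF p eta))
    (F_odd : forall v : R, -1 <= v <= 1 -> voteF p eta (- v) = - voteF p eta v)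
    (u_sol : mild_solution gamma zeta (voteF p eta) u)
    (Uoo_lim : forall x : R, u t x @[t --> +oo] --> Uoo x) :
  (gamma > Upsilon (voteF p eta) -> forall x : R, Uoo x = 0) /\
  (gamma < derive1 (voteF p eta) 0 ->
    ((Xi (voteF p eta))%:E <= limf_einf (fun x => (Uoo x)%:E) (pinfty_nbhs R))%E).
Proof.
have g0 : 0 < gamma := lt_trans ltr01 gamma_gt1.
set F := voteF p eta in F_C2 F_odd u_sol *.
have [f1 [f2 [df df1 _]]] := F_C2.
have [L L0 FL01] := is_derive_within_lipschitz df df1 ler01.
have FL := odd_lipschitz ler01 F_odd FL01.
have F_nd : forall v w : R, -1 <= v -> v <= w -> w <= 1 -> F v <= F w.
  exact: voteF_nondecreasing.
have F1 : F 1 = 1 by exact: voteF1.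
have F00 : F 0 = 0.
  by have := F_odd 0; rewrite oppr0 lerN10 ler01 => /(_ isT); lra.
(* [F] is controlled on [-1, 1] only; composed with the truncation it is odd, nondecreasing,
   Lipschitz and bounded by 1 on the whole line. *)
pose G v := F (clamp 1 v).
have cl (v : R) : -1 <= clamp 1 v <= 1 by rewrite -ler_norml normr_clamp.
have GF v : -1 <= v <= 1 -> G v = F v.
  by rewrite -ler_norml => v1; rewrite /G clamp_id.
have G_odd v : G (- v) = - G v by rewrite /G clampN// F_odd.
have G_nd v w : v <= w -> G v <= G w.
  move=> vw; have /andP[h1 _] := cl v; have /andP[_ h2] := cl w.
  by apply: F_nd => //; exact: clamp_nd.
have G_lip v w : `|G v - G w| <= L * `|v - w|.
  by rewrite (le_trans (FL _ _ (cl v) (cl w)))// ler_wpM2l// clamp_lip.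
have G_le1 v : `|G v| <= 1.
  have /andP[h1 h2] := cl v; rewrite ler_norml; apply/andP; split.
    have <- : F (-1) = -1 by rewrite F_odd ?F1// lexx andbT; lra.
    by apply: F_nd.
  by rewrite -F1; apply: F_nd.
clearbody G F.
have [mu_ u_bd u_mild] := u_sol.
(* Extension by 0 to negative times gives a bounded measurable function on the whole plane. *)
pose w t x := if 0 <= t then u t x else 0.
have mw : measurable_fun setT (fun z : R * R => w z.1 z.2).
  have mA : measurable [set z : R * R | 0 <= z.1].
    rewrite (_ : mkset _ = (fst : R * R -> R) @^-1` `[0, +oo[).
      by rewrite -[X in measurable X]setTI; exact: measurable_fst.
    by apply/seteqP; split => z /=; rewrite in_itv/= andbT.
  move/(measurable_restrictT _ mA) : mu_; congr measurable_fun.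
  by apply/funext => z; rewrite patchE /w mem_setE.
have w_le1 t x : `|w t x| <= 1.
  by rewrite /w; case: ifP => [t0|_]; rewrite ?normr0// ler_norml u_bd.
have wu t x : 0 <= t -> w t x = u t x by rewrite /w => ->.
clearbody w.
have wE t x : 0 <= t -> w t x =
    Emean zeta (fun p => kern gamma G w t (p.1, x + clock t p.1 * p.2)).
  move=> t0.
  have bv : bmeas (fun p : R * R => G (w p.1 (gamma^-1 * p.2))).
    apply: (@bmeas_le _ _ _ 1) => //; apply: measurableT_comp.
      by apply: continuous_measurable_fun; exact: (G_continuous L0 G_lip).
    apply: (measurableT_comp mw (g := fun p : R * R => (p.1, gamma^-1 * p.2))).
    by apply: measurable_fun_pair => //; exact: measurable_funM.
  rewrite -duhamel_kern// wu// u_mild//; congr (_ + _ * _).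
  apply: eq_Rintegral => s; rewrite inE/= in_itv/= => /andP[s0 _].
  congr killed_heat; apply/funext => y; rewrite wu// GF//; exact: u_bd.
have w_lim x : w t x @[t --> +oo] --> Uoo x.
  apply: cvg_trans (Uoo_lim x); apply: near_eq_cvg; near=> t.
  by rewrite wu//; near: t; apply: nbhs_pinfty_ge; exact: num_real.
split.
- move=> Yg.
  have Fv v : 0 < v <= 1 -> 0 <= F v <= L * v.
    move=> /andP[v0 v1]; apply/andP; split.
      by rewrite -F00; apply: F_nd => //; lra.
    have := FL v 0; rewrite F00 !subr0 (gtr0_norm v0) => h.
    by rewrite (le_trans (ler_norm _))// h//; apply/andP; split; lra.
  (* The Lipschitz constant bounds the ratios, so that [sup] is a true supremum. *)
  have Yub v : 0 < v <= 1 -> F v / v <= Upsilon F.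
    move=> hv; apply: ub_le_sup; last by exists v => //=; rewrite in_itv.
    exists L => _ [x /= hx <-]; move: hx; rewrite in_itv/= => hx.
    have /andP[x0 _] := hx; have /andP[_ h] := Fv _ hx.
    by rewrite ler_pdivrMr.
  have Y0 : 0 <= Upsilon F.
    apply: (@le_trans _ _ (F 1 / 1)); last by apply: Yub; rewrite ltr01 lexx.
    by rewrite F1 divr1.
  have GY v : `|v| <= 1 -> `|G v| <= Upsilon F * `|v|.
    have pos x : 0 < x -> x <= 1 -> `|G x| <= Upsilon F * `|x|.
      move=> x0 x1; have hx : 0 < x <= 1 by rewrite x0.
      rewrite GF; last by apply/andP; split; lra.
      have /andP[h _] := Fv _ hx.
      by rewrite (ger0_norm h) (gtr0_norm x0) -ler_pdivrMr// Yub.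
    rewrite ler_norml => /andP[v1 v2]; have [v0|v0|->] := ltrgtP v 0.
    - by rewrite -(normrN (G v)) -G_odd -(normrN v); apply: pos; lra.
    - exact: pos.
    - by rewrite GF ?F00 ?normr0 ?mulr0//; apply/andP; split; lra.
  exact: (U_vanish gamma_gt1 zeta_gt0 L0 G_odd G_lip G_le1 mw w_le1 wE w_lim Y0 Yg GY).
- move=> gF; apply: le_limf_einf_pinfty.
  rewrite (odd_derive1_0 ltr01 F_odd df) in gF.
  (* Midway between [gamma] and [f1 0]; the gap [f1 0 - b] is the error allowed in the first-order
     expansion, whence [b * v <= F v] near 0. *)
  pose b := (gamma + f1 0) / 2.
  have gb : gamma < b by rewrite /b; lra.
  have eb : 0 < f1 0 - b by rewrite /b; lra.
  have i0 : `[0, 1]%classic (0 : R) by rewrite /= in_itv/= lexx ler01.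
  have [d d0 Hd] := is_derive_within_approx df i0 eb.
  pose v0 := Num.min 1 (d / 2).
  have v0_gt0 : 0 < v0 by rewrite lt_min ltr01 divr_gt0.
  have v0_le1 : v0 <= 1 by rewrite ge_min lexx.
  have v0_ltd : v0 < d.
    by apply: (@le_lt_trans _ _ (d / 2)); [rewrite ge_min lexx orbT|lra].
  have Gb v : 0 <= v <= v0 -> b * v <= G v.
    move=> /andP[h0 hv]; rewrite GF; last by apply/andP; split; lra.
    have iv : `[0, 1]%classic v by rewrite /= in_itv/= h0 (le_trans hv).
    have := Hd v iv; rewrite F00 !subr0 ger0_norm// => /(_ (le_lt_trans hv v0_ltd)).
    by rewrite ler_norml => /andP[h _]; nra.
  have hv0 : 0 < v0 <= 1 by rewrite v0_gt0.
  have [l [/andP[l0 l1] Gl Ul]] := limit_fixpoint_bound gamma_gt1 zeta_gt0 L0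
    G_odd G_nd G_lip G_le1 mw w_le1 wE w_lim gb hv0 Gb.
  (* [l] lies in the set whose infimum is [Xi], so a constant below [Xi] is below [l]. *)
  move=> c cX; apply: Ul; apply: (lt_le_trans cX).
  apply: ge_inf; first by exists 0 => x [/andP[/ltW]].
  by split; [rewrite l0|rewrite -GF//; apply/andP; split; lra].
Unshelve. all: by end_near. Qed.
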